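(* The process $F$ has a modification which is locally Hölder continuous on $[0,\infty)$ with exponent $\gamma$ for any $\gamma<1/4$.
   Context: Fix $\alpha\in(0,1)$. Let $B=\{B(t):t\ge 0\}$ be a one-dimensional Brownian motion with random initial position, i.e. $B(t)=B(0)+W(t)$ with $W$ a standard Brownian motion started at $0$ and independent of $B(0)$. Assume $B(0)$ has a density $f\in C^\infty(\mathbb{R})$ that is a Schwartz function, i.e. $\sup_{x\in\mathbb{R}}(1+|x|^n)|f^{(m)}(x)|<\infty$ for all nonnegative integers $n,m$. Assume that $f(x)\,dx$ has a unique $\alpha$-quantile $q(0)$ (i.e. a unique number with $\int_{-\infty}^{q(0)}f(x)\,dx=\alpha$) and that $f(q(0))>0$. Let $u(x,t)$ denote the density of $B(t)$ (so $u(x,0)=f(x)$), and for $t>0$ let $q(t)$ be the (unique) $\alpha$-quantile of the law of $B(t)$. $F=\{F(t):t\ge 0\}$ is a centered Gaussian process with covariance function $$\rho(s,t)=E[F(s)F(t)]=\frac{P(B(s)\le q(s),\,B(t)\le q(t))-\alpha^2}{u(q(s),s)\,u(q(t),t)}.$$ *)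

(* Defs.v *)
From HB Require Import structures.
From mathcomp Require Import all_boot all_order all_algebra.
From mathcomp Require Import all_classical all_reals all_analysis.

Set Implicit Arguments.
Unset Strict Implicit.
Unset Printing Implicit Defensive.

Import Order.TTheory GRing.Theory Num.Theory.
Import numFieldNormedType.Exports.

Local Open Scope classical_set_scope.
Local Open Scope ring_scope.

Definition smooth (R : realType) (f : R -> R) : Prop :=
  forall (m : nat) (x : R), derivable (derive1n m f) x 1.

Definition schwartz (R : realType) (f : R -> R) : Prop :=
  smooth f /\
  forall n m : nat, exists C : R, forall x : R,
    (1 + `|x| ^+ n) * `|derive1n m f x| <= C.

Definition law_of_density (R : realType) (g : R -> R) (A : set R) : \bar R :=
  (\int[lebesgue_measure]_(x in A) (g x)%:E)%E.

Definition is_density (R : realType) (mu : set R -> \bar R) (g : R -> R) : Prop :=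
  [/\ measurable_fun setT g,
      (forall x, 0 <= g x) &
      (forall A : set R, measurable A -> mu A = law_of_density g A)].

Definition is_quantile (R : realType) (alpha : R) (mu : set R -> \bar R)
    (y : R) : Prop :=
  mu `]-oo, y]%classic = alpha%:E.

Definition is_unique_quantile (R : realType) (alpha : R)
    (mu : set R -> \bar R) (y : R) : Prop :=
  is_quantile alpha mu y /\ forall z, is_quantile alpha mu z -> z = y.

(* N(m, s^2) with s = 0 allowed.  The degenerate case is separate because
   [normal_prob m 0] is by convention the uniform law on [0, 1], not the Dirac
   mass at m. *)
Definition gauss_law (R : realType) (m s : R) (A : set R) : \bar R :=
  if s == 0 then \d_m A else normal_prob m s A.

Section Processes.
Context d (T : measurableType d) (R : realType) (P : probability T R).

(* Processes are indexed by all of R, but only times t >= 0 are relevant: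
   every definition below ignores the values at negative times. *)
Implicit Types X Y : R -> {RV P >-> R}.

Definition process_sigma X : set (set T) :=
  <<s \bigcup_(t in [set t : R | 0 <= t])
        preimage_set_system setT (X t) measurable >>.

Definition independent_sigma (G H : set (set T)) : Prop :=
  forall A B, G A -> H B -> P (A `&` B) = (P A * P B)%E.

Record standard_brownian_motion X : Prop := StandardBrownianMotion {
  bm_start : {ae P, forall w, X 0 w = 0} ;
  bm_independent_increments :
    forall (n : nat) (t : nat -> R) (A : nat -> set R),
      0 <= t 0%N -> (forall i, t i <= t i.+1) ->
      (forall i, measurable (A i)) ->
      P (\bigcap_(i in `I_n)
           [set w | A i (X (t i.+1) w - X (t i) w)]) =
      (\prod_(i < n) P [set w | A i (X (t i.+1) w - X (t i) w)%R])%E ;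
  bm_gaussian_increments :
    forall (s t : R) (A : set R), 0 <= s -> s <= t -> measurable A ->
      P [set w | A (X t w - X s w)] = gauss_law 0 (Num.sqrt (t - s)) A ;
  bm_continuous :
    {ae P, forall w, {within `[0, +oo[%classic, continuous (fun t => X t w)}}
}.

Definition gaussian_process X : Prop :=
  forall (n : nat) (t c : 'I_n -> R), (forall i, 0 <= t i) ->
  exists m s : R, forall A : set R, measurable A ->
    P [set w | A (\sum_(i < n) c i * X (t i) w)] = gauss_law m s A.

Definition centered X : Prop :=
  forall t, 0 <= t -> ('E_P[X t] = 0)%E.

(* The covariance is E[X(s) X(t)] only because this is used for centered X. *)
Definition has_covariance X (rho : R -> R -> R) : Prop :=
  forall s t, 0 <= s -> 0 <= t ->
    ('E_P[(fun w => (X s w * X t w)%R)] = (rho s t)%:E)%E.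

Definition modification X Y : Prop :=
  forall t, 0 <= t -> P [set w | Y t w = X t w] = 1%E.

Definition quantile_covariance (alpha : R) X (q : R -> R) (u : R -> R -> R)
    (s t : R) : R :=
  (fine (P [set w | X s w <= q s /\ X t w <= q t]) - alpha ^+ 2) /
  (u (q s) s * u (q t) t).

End Processes.

(* Local means on bounded sets: one constant per [0, M]. *)
Definition locally_holder (R : realType) (gamma : R) (g : R -> R) : Prop :=
  forall M : R, 0 < M -> exists C : R, forall s t : R,
    0 <= s <= M -> 0 <= t <= M -> `|g t - g s| <= C * `|t - s| `^ gamma.

(* Main.v *)
From HB Require Import structures.
Require Import Defs.
From mathcomp Require Import all_boot all_order all_algebra.
From mathcomp Require Import all_classical all_reals all_analysis.
From mathcomp Require Import measurable_realfun ring lra.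
Import Order.TTheory GRing.Theory Num.Theory.
Import numFieldNormedType.Exports.
Local Open Scope classical_set_scope.
Local Open Scope ring_scope.
Set Implicit Arguments.
Unset Strict Implicit.
Unset Printing Implicit Defensive.

(** Only an upper bound on E (F t - F s)^2 is needed. Write v t = u (q t) t for
    the density of B t at its quantile, a = alpha - alpha^2, and
    D = P (B s <= q s, q t < B t), so that
    P (B s <= q s, B t <= q t) = alpha - D. Expanding the covariances,
      E (F t - F s)^2 = a (1 / v t - 1 / v s)^2 + 2 D / (v s * v t),
    and the claim is that this is O(sqrt |t - s|) on every [0, N].

    The source of the estimate is that B 0 has a bounded, Lipschitz density and
    is independent of W. Given W, the event that B s <= y and x < B t says that
    B 0 lies in an interval of length at most |x - y| + |W t - W s|; averaging
    over W, its probability is O(|x - y| + sqrt |t - s|) ([crossing_bound]),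
    which bounds D once the displacement of the quantile is known. The same
    conditioning makes u Lipschitz in space and 1/2-Hoelder in time
    ([density_lipschitz]) and positive for t > 0 ([density_gt0]). When a
    distribution function has slope at least v t / 2 near its quantile and moves
    by O(sqrt |t - s|), the quantile moves by at most the ratio of the two
    ([quantile_displacement]). Hence v is continuous, bounded below on [0, N] by
    compactness, and there 1/2-Hoelder: the first term above is O(|t - s|) and
    the second O(sqrt |t - s|) ([covariance_increment]).

    It remains to pass from second moments to paths. A Gaussian variable of
    second moment D^2 has tails exp (- c (a / D)^2)
    ([gauss_law_tail_second_moment]). On the dyadic grid of mesh 2^-n the
    increments have D of order 2^(-n/4), so a union bound shows that almost
    surely they are all at most A (n + 1) 2^(-n/4), for a random A and all n at
    once ([dyadic_family_bounded]). For gamma < 1/4 this is O(2^(-n gamma)),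
    which forces the values of F at dyadic approximations of t to converge to a
    gamma-Hoelder function of t ([dyadic_lim_holder]). The same tail bound
    applied to F t_n - F t identifies the limit with F t almost surely. *)

(** * Sets defined by inequalities *)

Section comparison_sets.
Context d (T : measurableType d) (R : realType).
Implicit Types f g : T -> R.

Lemma measurable_lt_set f g : measurable_fun setT f -> measurable_fun setT g ->
  measurable [set x | f x < g x].
Proof.
move=> mf mg.
have -> : [set x | f x < g x] = setT `&` (g \- f) @^-1` `]0, +oo[.
  by rewrite setTI; apply/seteqP; split=> x /=; rewrite in_itv/= andbT subr_gt0.
by apply: measurable_funB.
Qed.

Lemma measurable_le_set f g : measurable_fun setT f -> measurable_fun setT g ->
  measurable [set x | f x <= g x].
Proof.
move=> mf mg.
have -> : [set x | f x <= g x] = ~` [set x | g x < f x].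
  by apply/seteqP; split=> x /=; rewrite leNgt => /negP.
exact/measurableC/measurable_lt_set.
Qed.

End comparison_sets.

(** * Gaussian tails *)

Section gaussian_estimates.
Variable R : realType.
Implicit Types m s x a D : R.
Notation mu := (@lebesgue_measure R).

(** Doubling the standard deviation leaves a Gaussian factor to spare. It can
    absorb a tail or a power of |x - m|, so that both estimates below reduce to
    the total mass of the wider density. *)
Lemma normal_pdf_double m s x : s != 0 ->
  normal_pdf m s x =
  2 * expR (- (3 / 8 * ((x - m) / s) ^+ 2)) * normal_pdf m (2 * s) x.
Proof.
move=> s0; have s20 : 2 * s != 0 by rewrite mulf_neq0.
rewrite !normal_pdfE// /normal_peak /normal_fun.
have -> : Num.sqrt ((2 * s) ^+ 2 * pi *+ 2) = 2 * Num.sqrt (s ^+ 2 * pi *+ 2).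
  by rewrite exprMn -mulrA -mulrnAr sqrtrM ?sqr_ge0// sqrtr_sqr ger0_norm.
have -> : expR (- (x - m) ^+ 2 / (s ^+ 2 *+ 2)) =
    expR (- (3 / 8 * ((x - m) / s) ^+ 2)) *
    expR (- (x - m) ^+ 2 / ((2 * s) ^+ 2 *+ 2)).
  by rewrite -expRD; congr expR; field.
by rewrite invfM; set p := (Num.sqrt _)^-1; field.
Qed.

Let measurable_tail m a : measurable [set x | a < `|x - m|].
Proof.
apply: measurable_lt_set => //; apply: measurableT_comp => //.
exact: measurable_funB.
Qed.

Lemma gauss_law_tail m s a : 0 <= a ->
  (gauss_law m s [set x | (a < `|x - m|)%R]
    <= (2 * expR (- (3 / 8 * (a / s) ^+ 2)))%:E)%E.
Proof.
move=> a0; rewrite /gauss_law; case: ifPn => [_|s0].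
  rewrite /dirac indicE memNset ?lee_fin ?mulr_ge0 ?expR_ge0//=.
  by rewrite subrr normr0 ltNge a0.
rewrite /normal_prob.
set c := (2 * _)%R.
apply: (@le_trans _ _ (\int[mu]_(x in [set x | (a < `|x - m|)%R])
    (c * normal_pdf m (2 * s) x)%:E)%E).
  apply: ge0_le_integral => //=.
  - exact: measurable_tail.
  - by move=> x _; rewrite lee_fin normal_pdf_ge0.
  - by apply/measurable_funTS/measurable_EFinP; exact: measurable_normal_pdf.
  - apply/measurable_funTS/measurable_EFinP; apply: measurable_funM => //.
    exact: measurable_normal_pdf.
  - move=> x ax; rewrite lee_fin (normal_pdf_double _ _ s0).
    rewrite ler_wpM2r ?normal_pdf_ge0// ler_pM2l// ler_expR lerN2 ler_pM2l//.
    rewrite !exprMn ler_wpM2r ?sqr_ge0// -[leRHS]real_normK ?num_real//.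
    by rewrite lerXn2r ?nnegrE// ltW.
apply: (@le_trans _ _ (\int[mu]_x (c * normal_pdf m (2 * s) x)%:E)%E).
  apply: ge0_subset_integral => //=.
  - exact: measurable_tail.
  - apply/measurable_EFinP; apply: measurable_funM => //.
    exact: measurable_normal_pdf.
  - by move=> x _; rewrite lee_fin mulr_ge0 ?normal_pdf_ge0// mulr_ge0.
under eq_integral do rewrite EFinM.
rewrite ge0_integralZl ?integral_normal_pdf ?mule1//.
- by apply/measurable_EFinP; exact: measurable_normal_pdf.
- by move=> x _; rewrite lee_fin normal_pdf_ge0.
- by rewrite lee_fin mulr_ge0// expR_ge0.
Qed.

(** A probability given by its density is also given by its Radon-Nikodym
    derivative, and the two agree almost everywhere. *)
Lemma ge0_integral_normal_prob m s (f : R -> \bar R) :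
  measurable_fun setT f -> (forall x, 0 <= f x)%E ->
  (\int[normal_prob m s]_x f x = \int[mu]_x (f x * (normal_pdf m s x)%:E))%E.
Proof.
move=> mf f0; have dom := normal_prob_dominates m s.
have mpdf : measurable_fun setT (EFin \o normal_pdf m s).
  by apply/measurable_EFinP; exact: measurable_normal_pdf.
have iRN := Radon_Nikodym_SigmaFinite.f_integrable dom.
rewrite -(Radon_Nikodym_SigmaFinite.change_of_variables dom)//.
apply: ae_eq_integral => //.
- by apply: emeasurable_funM => //; exact: measurable_int iRN.
- exact: emeasurable_funM.
apply: ae_eqe_mul2l; apply: integral_ae_eq => // A _ mA.
by rewrite -Radon_Nikodym_SigmaFinite.f_integral.
Qed.

Lemma integral_abs_normal_pdf s : 0 < s ->
  (\int[mu]_x (`|x| * normal_pdf 0 s x)%R%:E <= (2 * s)%:E)%E.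
Proof.
move=> s0; have sn0 : s != 0 by rewrite gt_eqF.
have quadratic (y : R) : y <= 1 + 3 / 8 * y ^+ 2.
  by have := sqr_ge0 (y - 4 / 3); nra.
apply: (@le_trans _ _ (\int[mu]_x ((2 * s) * normal_pdf 0 (2 * s) x)%:E)%E).
  apply: ge0_le_integral => //=.
  - by move=> x _; rewrite lee_fin mulr_ge0// normal_pdf_ge0.
  - apply/measurable_EFinP; apply: measurable_funM; last first.
      exact: measurable_normal_pdf.
    exact: normr_measurable.
  - apply/measurable_EFinP; apply: measurable_funM => //.
    exact: measurable_normal_pdf.
  - move=> x _; rewrite lee_fin (normal_pdf_double _ _ sn0) mulrA.
    rewrite ler_wpM2r ?normal_pdf_ge0// mulrCA ler_pM2l// subr0 expRN.
    rewrite ler_pdivrMr ?expR_gt0//.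
    (* y exp (- 3 y^2 / 8) <= 1 for y = |x| / s *)
    apply: (@le_trans _ _ (s * (1 + 3 / 8 * (x / s) ^+ 2))); last first.
      by rewrite ler_pM2l// expR_ge1Dx.
    have -> : (x / s) ^+ 2 = (`|x| / s) ^+ 2.
      by rewrite !exprMn real_normK// num_real.
    by rewrite -[leLHS](divfK sn0) mulrC ler_pM2l.
under eq_integral do rewrite EFinM.
rewrite ge0_integralZl ?integral_normal_pdf ?mule1//.
- by apply/measurable_EFinP; exact: measurable_normal_pdf.
- by move=> x _; rewrite lee_fin normal_pdf_ge0.
- by rewrite lee_fin mulr_ge0// ltW.
Qed.

(** The peak of the density is 1 / (|s| sqrt (2 pi)), and 2 <= sqrt (2 pi). *)
Lemma gauss_law_ball m s (b : R) : s != 0 -> 0 <= b ->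
  (gauss_law m s [set x | (`|x| <= b)%R] <= (b / `|s|)%:E)%E.
Proof.
move=> s0 b0; rewrite /gauss_law (negbTE s0) /normal_prob.
have -> : [set x | `|x| <= b] = `[- b, b]%classic.
  by apply/seteqP; split=> x /=; rewrite in_itv/= ler_norml.
apply: (@le_trans _ _ (\int[mu]_(x in `[(- b)%R, b]) (normal_peak s)%:E)%E).
  apply: ge0_le_integral => //=.
  - by move=> x _; rewrite lee_fin normal_pdf_ge0.
  - by apply/measurable_funTS/measurable_EFinP; exact: measurable_normal_pdf.
  - by move=> x _; rewrite lee_fin normal_pdf_ub.
rewrite integral_cst//= lebesgue_measure_itv/= lte_fin.
case: ifPn => [_|_]; last by rewrite mule0 lee_fin divr_ge0.
rewrite -EFinB -EFinM lee_fin opprK mulrC ler_pdivlMr ?normr_gt0//.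
have p2 : 2 <= pi :> R := pi_ge2 R.
have sq : 2 * `|s| <= Num.sqrt (s ^+ 2 * pi *+ 2).
  rewrite -(@ger0_norm _ 2)// -normrM -sqrtr_sqr ler_sqrt; last first.
    by rewrite mulrn_wge0// mulr_ge0 ?sqr_ge0 ?pi_ge0.
  rewrite exprMn -mulr_natr; have := sqr_ge0 s; nra.
have sq0 : 0 < Num.sqrt (s ^+ 2 * pi *+ 2).
  by rewrite (lt_le_trans _ sq)// mulr_gt0 ?normr_gt0.
rewrite /normal_peak mulrAC ler_pdivrMr//.
apply: (le_trans _ (ler_wpM2l b0 sq)).
by rewrite mulrA mulr_natr mulr2n.
Qed.

Section random_variable.
Context d (T : measurableType d) (P : probability T R).

Lemma ge0_integral_law (X : {RV P >-> R})
    (m : {measure set (measurableTypeR R) -> \bar R}) (f : R -> \bar R) :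
  (forall A, measurable A -> P [set w | A (X w)] = m A) ->
  measurable_fun setT f -> (forall x, 0 <= f x)%E ->
  (\int[P]_w f (X w) = \int[m]_x f x)%E.
Proof.
move=> XE mf f0.
(* m lives on a copy of R that differs from the target of X in its display *)
pose X' : T -> measurableTypeR R := X.
have mX : measurable_fun setT X'.
  by move=> _ A mA; exact: (@measurable_funPT _ _ _ _ X measurableT A).
pose Y : {mfun T >-> measurableTypeR R} :=
  HB.pack X' (isMeasurableFun.Build _ _ _ _ _ mX).
transitivity (\int[pushforward P Y]_x f x)%E.
  by rewrite ge0_integral_pushforward.
by apply: eq_measure_integral => A mA _; rewrite [LHS](XE A mA).
Qed.

Lemma gauss_law0_expectation_abs (X : {RV P >-> R}) s : 0 <= s ->
  (forall A, measurable A -> P [set w | A (X w)] = gauss_law 0 s A) ->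
  (\int[P]_w (`|X w|)%:E <= (2 * s)%:E)%E.
Proof.
rewrite le_eqVlt => /predU1P[<- XE|s0 XE].
  rewrite mulr0 (@ae_eq_integral _ _ _ P setT (cst 0%E))//.
  - by rewrite integral0.
  - by apply/measurable_EFinP; exact: measurableT_comp.
  - exists [set w | X w <> 0]; split => //.
    + have -> : [set w | X w <> 0] = X @^-1` (~` [set 0]) by [].
      by apply: measurable_funPTI; exact: measurableC.
    + rewrite [LHS](XE (~` [set 0])); last exact: measurableC.
      by rewrite /gauss_law eqxx /dirac indicE memNset//; exact.
    + by move=> w /= nw X0; apply: nw => _; rewrite X0 normr0.
have mabs : measurable_fun setT (fun x : R => (`|x|)%:E).
  by apply/measurable_EFinP; exact: normr_measurable.
rewrite (@ge0_integral_law X (normal_prob 0 s) (fun x => (`|x|)%:E))//;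
  last first.
  by move=> A mA; rewrite [LHS]XE// /gauss_law gt_eqF.
rewrite ge0_integral_normal_prob//.
exact: integral_abs_normal_pdf.
Qed.

(** By Chebyshev, |X| <= 2 D with probability at least 3/4. A law N(m, s^2) with
    s large is too spread out to put that mass in a ball of radius 2 D; and if m
    were large compared with both D and s, the ball would lie in a tail of mass
    less than 3/4. *)
Lemma gauss_law_parameter_bounds (X : {RV P >-> R}) m s D : 0 < D ->
  (forall A, measurable A -> P [set w | A (X w)] = gauss_law m s A) ->
  (\int[P]_w ((X w) ^+ 2)%:E <= (D ^+ 2)%:E)%E ->
  `|s| <= 3 * D /\ `|m| <= 11 * D.
Proof.
move=> D0 XE XD.
have mX : measurable_fun setT (X : T -> R) by [].
have mabsX : measurable_fun setT (fun w => `|X w|).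
  exact: measurableT_comp.
pose A := [set w | `|X w| <= 2 * D].
have mA : measurable A by exact: measurable_le_set.
have PA : ((3 / 4)%:E <= P A)%E.
  have mE : measurable [set w | (2 * D)%:E <= `|(X w)%:E|]%E.
    exact: (@measurable_le_set _ _ R (cst (2 * D)) (fun w => `|X w|)).
  have PC : (P (~` A) <= (1 / 4)%:E)%E.
    have : (((2 * D) ^+ 2)%:E * P [set w | (2 * D)%:E <= `|(X w)%:E|] <=
       'E_P[((fun x : R => (x ^+ 2)%R) \o Num.norm \o X)])%E.
      apply: (markov _ (f := fun x : R => x ^+ 2)); rewrite ?mulr_gt0//.
      - by move=> r _; exact: sqr_ge0.
      - by move=> x y; rewrite !nnegrE => x0 y0; rewrite ler_pXn2r.
    rewrite unlock (_ : (\int[P]_w _)%E =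
      (\int[P]_w ((X w) ^+ 2)%:E)%E); last first.
      by apply: eq_integral => w _ /=; rewrite real_normK ?num_real.
    move=> /le_trans/(_ XD) PE.
    have PC : (P (~` A) <= P [set w | (2 * D)%:E <= `|(X w)%:E|])%E.
      rewrite le_measure ?inE//; first exact: measurableC.
      by move=> w /= /negP; rewrite -ltNge lee_fin => /ltW.
    rewrite -(@lee_pmul2l _ ((2 * D) ^+ 2)%:E)//; last first.
      by rewrite lte_fin exprn_gt0// mulr_gt0.
    apply: (le_trans (lee_wpmul2l _ PC)); first by rewrite lee_fin sqr_ge0.
    by rewrite (le_trans PE)// -EFinM lee_fin; nra.
  have := probability_setC P mA.
  have := PC.
  rewrite -(fineK (fin_num_measure P A mA)).
  rewrite -(fineK (fin_num_measure P (~` A) (measurableC mA))).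
  by rewrite -EFinB !lee_fin => + []; move: (fine _) (fine _) => x y; lra.
have XA : P A = gauss_law m s [set x | `|x| <= 2 * D].
  rewrite -XE//.
  by apply: measurable_le_set => //; exact: normr_measurable.
have sD : `|s| <= 3 * D.
  have [->|s0] := eqVneq s 0; first by rewrite normr0 mulr_ge0// ltW.
  have := le_trans PA (_ : (P A <= (2 * D / `|s|)%:E)%E).
  rewrite {1}XA => /(_ (gauss_law_ball m s0 _)).
  have D2 : 0 <= 2 * D by lra.
  by move=> /(_ D2); rewrite lee_fin ler_pdivlMr ?normr_gt0//; lra.
split=> //; rewrite leNgt; apply/negP => mD.
have : (P A < (3 / 4)%:E)%E; last by rewrite ltNge PA.
have mB : measurable [set x | 3 * `|s| < `|x - m|].
  exact: measurable_tail.
apply: (@le_lt_trans _ _ (gauss_law m s [set x | (3 * `|s| < `|x - m|)%R])).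
  rewrite -XE// le_measure ?inE//.
    rewrite -[X in measurable X]/(X @^-1` [set x | 3 * `|s| < `|x - m|]).
    exact: measurable_funPTI.
  move=> w /=; rewrite /A/= => XwD.
  have : `|m| <= `|X w - m| + `|X w|.
    by rewrite -{1}(subKr (X w) m) (le_trans (ler_normB _ _))// addrC.
  lra.
(* for s != 0 the tail beyond 3 |s| has mass at most 2 exp (- 27 / 8) *)
have [s0|s0] := eqVneq s 0.
  rewrite /gauss_law s0 eqxx /dirac indicE memNset/= ?lte_fin ?divr_gt0//.
  by rewrite subrr normr0 mulr0 ltxx.
apply: (le_lt_trans (gauss_law_tail _ _ _)); first by rewrite mulr_ge0.
rewrite lte_fin (_ : 3 / 8 * _ ^+ 2 = 27 / 8).
  rewrite expRN ltr_pdivrMr ?expR_gt0//.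
  have := @expR_ge1Dx R (27 / 8); lra.
rewrite !exprMn exprVn real_normK ?num_real//.
by field.
Qed.

(** For a >= 22 D, twice the bound on |m|, the event forces |X - m| > a / 2,
    which is a Gaussian tail with |s| <= 3 D. The additive 6 makes the bound
    trivial for smaller a, where (a / 10 D)^2 < 5. *)
Lemma gauss_law_tail_second_moment (X : {RV P >-> R}) m s D a :
  0 < D -> 0 <= a ->
  (forall A, measurable A -> P [set w | A (X w)] = gauss_law m s A) ->
  (\int[P]_w ((X w) ^+ 2)%:E <= (D ^+ 2)%:E)%E ->
  (P [set w | (a < `|X w|)%R] <= (expR (6 - (a / (10 * D)) ^+ 2))%:E)%E.
Proof.
move=> D0 a0 XE XD; have [sD mD] := gauss_law_parameter_bounds D0 XE XD.
have mtail : measurable [set w | a < `|X w|].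
  by apply: measurable_lt_set => //; exact: measurableT_comp.
have [aD|aD] := ltP a (22 * D).
  apply: (le_trans (probability_le1 _ _)) => //.
  rewrite lee_fin (le_trans _ (expR_ge1Dx _))// lerDl subr_ge0.
  rewrite -(@ler_pM2r _ ((10 * D) ^+ 2)) ?exprn_gt0 ?mulr_gt0//.
  by rewrite -exprMn divfK ?mulf_neq0 ?gt_eqF//; nra.
apply: (@le_trans _ _ (gauss_law m s [set x | (a / 2 < `|x - m|)%R])).
  rewrite -XE// le_measure ?inE//.
    rewrite -[X in measurable X]/(X @^-1` [set x | a / 2 < `|x - m|]).
    exact: measurable_funPTI.
  move=> w /= aX.
  have : `|X w| <= `|X w - m| + `|m|.
    by rewrite -{1}(subrK m (X w)) ler_normD.
  lra.
have [s0|s0] := eqVneq s 0.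
  rewrite /gauss_law s0 eqxx /dirac indicE memNset/= ?lee_fin ?expR_ge0//.
  by rewrite subrr normr0 ltNge divr_ge0.
apply: (le_trans (gauss_law_tail _ _ _)); first by rewrite divr_ge0.
rewrite lee_fin expRD.
have e2 : 2 <= expR 6 :> R by have := @expR_ge1Dx R 6; lra.
apply: ler_pM; rewrite ?expR_ge0// ler_expR lerN2.
rewrite !exprMn !exprVn !exprMn.
have s2 : s ^+ 2 <= (3 * D) ^+ 2.
  by rewrite -[leLHS]real_normK ?num_real// ler_sqr ?nnegrE ?mulr_ge0// ltW.
rewrite ler_pdivrMr; last by rewrite mulr_gt0 ?exprn_gt0.
have s20 : 0 < s ^+ 2 by rewrite exprn_even_gt0.
have a2 : 0 <= a ^+ 2 by rewrite sqr_ge0.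
rewrite (_ : _ * _ = a ^+ 2 * (75 / 8 * D ^+ 2 / s ^+ 2)); last by field.
rewrite -[leLHS]mulr1 ler_wpM2l// ler_pdivlMr// mul1r.
by rewrite exprMn in s2; nra.
Qed.

End random_variable.
End gaussian_estimates.

(** * Hoelder continuity from dyadic increments *)

Section dyadic_holder.
Variable R : realType.
Implicit Types (t s theta gamma C : R) (g : R -> R) (n k K : nat).

Lemma geometric_cauchy_lim (a : nat -> R) theta C : 0 < theta < 1 -> 0 <= C ->
  (forall n, `|a n.+1 - a n| <= C * theta ^+ n) ->
  cvgn a /\ forall n, `|limn a - a n| <= C / (1 - theta) * theta ^+ n.
Proof.
move=> /andP[t0 t1] C0 aC; set c := C / (1 - theta).
have c0 : 0 <= c by rewrite divr_ge0// subr_ge0 ltW.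
have cE : C = c * (1 - theta) by rewrite divfK// subr_eq0 gt_eqF.
(* a n -+ c theta^n are monotone, in opposite directions *)
pose lo n := a n - c * theta ^+ n; pose hi n := a n + c * theta ^+ n.
have loS n : lo n <= lo n.+1.
  by have := aC n; rewrite ler_norml /lo cE exprS; nra.
have hiS n : hi n.+1 <= hi n.
  by have := aC n; rewrite ler_norml /hi cE exprS; nra.
have lo_nd : nondecreasing_seq lo by apply/nondecreasing_seqP.
have hi_ni : nonincreasing_seq hi by apply/nonincreasing_seqP.
have lohi n m : lo n <= hi m.
  have th0 j : 0 <= theta ^+ j by rewrite exprn_ge0// ltW.
  have lohi j : lo j <= hi j.
    by rewrite /lo /hi; have := mulr_ge0 c0 (th0 j); lra.
  apply: (le_trans (lo_nd _ _ (leq_maxl n m))).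
  exact: (le_trans (lohi _) (hi_ni _ _ (leq_maxr n m))).
have cvlo : cvgn lo.
  by apply: nondecreasing_is_cvgn => //; exists (hi 0%N) => _ [n _ <-].
have aE : a = lo \+ (fun n => c * theta ^+ n).
  by apply/funext => n; rewrite /lo/= subrK.
have geo0 : (fun n => c * theta ^+ n) @ \oo --> (0 : R).
  by apply: cvg_geometric; rewrite gtr0_norm.
have alim : a @ \oo --> limn lo.
  by rewrite -[limn lo]addr0 aE; apply: cvgD.
split; first by apply/cvg_ex; exists (limn lo).
move=> n; rewrite (cvg_lim _ alim)// ler_norml.
have h1 : lo n <= limn lo by exact: nondecreasing_cvgn_le.
have h2 : limn lo <= hi n.
  by apply: limr_le => //; apply: nearW => m.
by move: h1 h2; rewrite /lo /hi; lra.
Qed.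

(** For t < 0 this is 0, because [Num.truncn] vanishes there. *)
Definition dyadic_floor t n : R := (Num.truncn (t * 2 ^+ n))%:R / 2 ^+ n.

Lemma dyadic_floor_itv t n : 0 <= t ->
  dyadic_floor t n <= t < dyadic_floor t n + 2 ^- n.
Proof.
move=> t0; have p0 : 0 < 2 ^+ n :> R by rewrite exprn_gt0.
have /truncn_itv/andP[h1 h2] : 0 <= t * 2 ^+ n by rewrite mulr_ge0// ltW.
rewrite /dyadic_floor ler_pdivrMr// h1.
by rewrite -[X in _ + X]mul1r -mulrDl natr1 ltr_pdivlMr.
Qed.

Lemma truncn_dyadicS t n : 0 <= t ->
  Num.truncn (t * 2 ^+ n.+1) = (Num.truncn (t * 2 ^+ n)).*2 \/
  Num.truncn (t * 2 ^+ n.+1) = (Num.truncn (t * 2 ^+ n)).*2.+1.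
Proof.
move=> t0; have p0 : 0 <= t * 2 ^+ n by rewrite mulr_ge0.
have /andP[h1 h2] := truncn_itv p0.
set k := Num.truncn (t * 2 ^+ n) in h1 h2 *.
rewrite exprS mulrCA mulrC.
have q0 : 0 <= t * 2 ^+ n * 2 by rewrite mulr_ge0.
have [h|h] := ltP (t * 2 ^+ n * 2) (k.*2.+1)%:R; [left|right].
  apply/eqP; rewrite truncn_eq// h andbT -muln2 natrM.
  by rewrite ler_wpM2r.
apply/eqP; rewrite truncn_eq// h /= -(doubleS k) -muln2 natrM.
by rewrite ltr_pM2r.
Qed.

Lemma truncn_dyadic_step s t n : 0 <= s -> s <= t -> t - s <= 2 ^- n ->
  Num.truncn (t * 2 ^+ n) = Num.truncn (s * 2 ^+ n) \/
  Num.truncn (t * 2 ^+ n) = (Num.truncn (s * 2 ^+ n)).+1.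
Proof.
move=> s0 st tsn; have p0 : 0 < 2 ^+ n :> R by rewrite exprn_gt0.
have sp0 : 0 <= s * 2 ^+ n by rewrite mulr_ge0// ltW.
have stp : s * 2 ^+ n <= t * 2 ^+ n by rewrite ler_pM2r.
have tp0 : 0 <= t * 2 ^+ n by exact: le_trans stp.
have tsp : t * 2 ^+ n <= s * 2 ^+ n + 1.
  by rewrite -lerBlDl -mulrBl -ler_pdivlMr// mul1r.
have /andP[h1 h2] := truncn_itv sp0.
set k := Num.truncn (s * 2 ^+ n) in h1 h2 *.
have [h|h] := ltP (t * 2 ^+ n) (k.+1)%:R; [left|right].
  by apply/eqP; rewrite truncn_eq// h andbT (le_trans h1).
apply/eqP; rewrite truncn_eq// h /= (le_lt_trans tsp)//.
by rewrite -[ltRHS]natr1 ltrD2r.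
Qed.

Lemma dyadic_scale (x : R) : 0 < x <= 1 ->
  exists n, [/\ x <= 2 ^- n & 2 ^- n.+1 < x].
Proof.
move=> /andP[x0 x1].
have ex : exists m, 2 ^- m < x.
  exists (Num.truncn x^-1).+1.
  rewrite invf_plt ?posrE ?exprn_gt0//.
  rewrite (lt_le_trans (truncnS_gt _))// -natrX ler_nat.
  by rewrite ltnW// ltn_expl.
case: (ex_minnP ex) => -[|n]; first by rewrite expr0 invr1 ltNge x1.
move=> nx min; exists n; split=> //; rewrite leNgt; apply/negP => /min.
by rewrite ltnn.
Qed.

Variables (g : R -> R) (K : nat) (theta C : R).
Hypotheses (theta01 : 0 < theta < 1) (C0 : 0 <= C).
Hypothesis gC : forall n k, (k < K * 2 ^ n)%N ->
  `|g (k.+1%:R / 2 ^+ n) - g (k%:R / 2 ^+ n)| <= C * theta ^+ n.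

Let theta_gt0 : 0 < theta. Proof. by case/andP: theta01. Qed.
Let theta_lt1 : theta < 1. Proof. by case/andP: theta01. Qed.

Definition dyadic_lim g t := limn (fun n => g (dyadic_floor t n)).

Let trunc_le t n : 0 <= t <= K%:R -> (Num.truncn (t * 2 ^+ n) <= K * 2 ^ n)%N.
Proof.
move=> /andP[t0 tK]; rewrite -(ler_nat R) natrM natrX.
have p0 : 0 <= 2 ^+ n :> R by rewrite exprn_ge0.
by rewrite (le_trans _ (ler_wpM2r p0 tK))// truncn_le mulr_ge0.
Qed.

(* refining the approximation of t moves it by at most one step of the finer
   grid, so the successive values of g differ by at most C theta^n *)
Let dyadic_lim_bound t : 0 <= t <= K%:R ->
  cvgn (fun n => g (dyadic_floor t n)) /\ forall n,
  `|dyadic_lim g t - g (dyadic_floor t n)| <= C / (1 - theta) * theta ^+ n.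
Proof.
move=> tK; have /andP[t0 _] := tK.
apply: (geometric_cauchy_lim theta01 C0) => n.
have kK := trunc_le n.+1 tK; rewrite /dyadic_floor.
have dbl : (Num.truncn (t * 2 ^+ n))%:R / 2 ^+ n =
    (Num.truncn (t * 2 ^+ n)).*2%:R / 2 ^+ n.+1 :> R.
  by rewrite -muln2 natrM exprS; field; rewrite expf_neq0.
rewrite dbl; case: (truncn_dyadicS n t0) kK => -> kK.
  by rewrite subrr normr0 mulr_ge0// exprn_ge0// ltW.
apply: (le_trans (gC kK)); rewrite ler_wpM2l// exprS.
by rewrite ler_piMl ?exprn_ge0// ltW.
Qed.

Lemma cvg_dyadic_lim t : 0 <= t <= K%:R ->
  (fun n => g (dyadic_floor t n)) @ \oo --> dyadic_lim g t.
Proof. by move=> /dyadic_lim_bound[]. Qed.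

Let dyadic_floor_step s t n : 0 <= s -> s <= t -> t <= K%:R ->
  t - s <= 2 ^- n ->
  `|g (dyadic_floor t n) - g (dyadic_floor s n)| <= C * theta ^+ n.
Proof.
move=> s0 st tK tsn; rewrite /dyadic_floor.
have kK : (Num.truncn (t * 2 ^+ n) <= K * 2 ^ n)%N.
  by apply: trunc_le; rewrite tK (le_trans s0).
case: (truncn_dyadic_step s0 st tsn) kK => -> kK; last exact: gC.
by rewrite subrr normr0 mulr_ge0// exprn_ge0// ltW.
Qed.

Let integer_bound j : (j <= K)%N -> `|g (j%:R / 2 ^+ 0) - g 0| <= C * K%:R.
Proof.
move=> jK; apply: (@le_trans _ _ (C * j%:R)); last first.
  by rewrite ler_wpM2l// ler_nat.
elim: j jK => [|j IH] jK; first by rewrite expr0 divr1 subrr normr0 mulr0.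
have -> : g (j.+1%:R / 2 ^+ 0) - g 0 =
  (g (j.+1%:R / 2 ^+ 0) - g (j%:R / 2 ^+ 0)) + (g (j%:R / 2 ^+ 0) - g 0).
  by rewrite addrA subrK.
rewrite (le_trans (ler_normD _ _))// -[X in C * X]natr1 mulrDr mulr1 addrC.
apply: lerD; first exact/IH/ltnW.
by rewrite (le_trans (gC _)) ?muln1// expr0 mulr1.
Qed.

(** If 2^-(n+1) < t - s <= 2^-n, then the level-n approximations of s and t are
    equal or adjacent, so the limits differ by O(theta^n), which is
    O((t - s)^gamma): each limit is within O(theta^n) of its level-n
    approximation. *)
Lemma dyadic_lim_holder gamma : 0 < gamma -> theta = 2 `^ (- gamma) ->
  exists C', forall s t, 0 <= s <= K%:R -> 0 <= t <= K%:R ->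
    `|dyadic_lim g t - dyadic_lim g s| <= C' * `|t - s| `^ gamma.
Proof.
move=> gamma0 thetaE; set c := C / (1 - theta).
have c0 : 0 <= c by rewrite divr_ge0// subr_ge0 ltW.
have theta0 n : 0 <= theta ^+ n by rewrite exprn_ge0// ltW.
have CK0 : 0 <= C * K%:R by rewrite mulr_ge0.
have D0 : 0 <= (2 * c + C) / theta.
  apply: divr_ge0; last exact: ltW.
  by apply: addr_ge0 => //; exact: mulr_ge0.
pose C' := (2 * c + C) / theta + (2 * c + 2 * (C * K%:R)).
have C'0 : 0 <= C' by apply: addr_ge0 => //; apply: addr_ge0; apply: mulr_ge0.
suff ordered s t : 0 <= s -> s < t -> t <= K%:R ->
    `|dyadic_lim g t - dyadic_lim g s| <= C' * (t - s) `^ gamma.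
  exists C' => s t /andP[s0 sK] /andP[t0 tK].
  have [st|ts|->] := ltgtP s t.
  - by rewrite [`|t - s|]gtr0_norm ?subr_gt0//; exact: ordered.
  - rewrite distrC [`|t - s|]distrC [`|s - t|]gtr0_norm ?subr_gt0//.
    exact: ordered.
  - by rewrite !subrr normr0 mulr_ge0// powR_ge0.
move=> s0 st tK; set x := t - s.
have x0 : 0 < x by rewrite subr_gt0.
have sK : 0 <= s <= K%:R by rewrite s0/= (le_trans _ tK)// ltW.
have tK' : 0 <= t <= K%:R by rewrite tK (le_trans s0)// ltW.
have split n : `|dyadic_lim g t - dyadic_lim g s| <=
    2 * c * theta ^+ n + `|g (dyadic_floor t n) - g (dyadic_floor s n)|.
  have [_ /(_ n)] := dyadic_lim_bound tK'.
  have [_ /(_ n)] := dyadic_lim_bound sK.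
  rewrite -/c; set a := dyadic_lim g t; set b := dyadic_lim g s.
  set a' := g _; set b' := g _ => hb ha.
  have -> : a - b = (a - b') - (b - a') + (b' - a') by ring.
  rewrite (le_trans (ler_normD _ _))// lerD//.
  by rewrite (le_trans (ler_normB _ _))//; lra.
have [x1|x1] := leP x 1.
  have [n [xn nx]] : exists n, [/\ x <= 2 ^- n & 2 ^- n.+1 < x].
    by apply: dyadic_scale; rewrite x0.
  apply: (le_trans (split n)).
  have /(lerD (lexx (2 * c * theta ^+ n))) :=
    dyadic_floor_step s0 (ltW st) tK xn.
  move=> /le_trans; apply; rewrite -mulrDl.
  have thx : theta ^+ n.+1 <= x `^ gamma.
    rewrite thetaE -powR_mulrn ?powR_ge0// -powRrM mulNr mulrC -mulNr powRrM.
    rewrite powR_invn//; apply: ge0_ler_powR; rewrite ?nnegrE ?ltW//.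
  apply: (@le_trans _ _ ((2 * c + C) / theta * theta ^+ n.+1)).
    by rewrite exprS mulrA divfK ?gt_eqF.
  apply: (@le_trans _ _ ((2 * c + C) / theta * x `^ gamma)).
    by rewrite ler_wpM2l.
  by rewrite ler_wpM2r ?powR_ge0// lerDl; apply: addr_ge0; apply: mulr_ge0.
(* when t - s > 1 it suffices to be bounded, through the integer grid *)
have xg : 1 <= x `^ gamma by rewrite -(powRr0 x) ler_powR ?ltW.
apply: (le_trans (split 0%N)); rewrite expr0 mulr1.
apply: (@le_trans _ _ (2 * c + 2 * (C * K%:R))); last first.
  rewrite (@le_trans _ _ C')//; first by rewrite lerDr.
  by rewrite ler_peMr.
have int0 r : 0 <= r <= K%:R -> `|g (dyadic_floor r 0) - g 0| <= C * K%:R.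
  by move=> /trunc_le => /(_ 0%N); rewrite expn0 muln1 => /integer_bound.
rewrite lerD2l; set a := g (dyadic_floor t 0); set b := g (dyadic_floor s 0).
have -> : a - b = (a - g 0) - (b - g 0) by ring.
rewrite (le_trans (ler_normB _ _))// mulr_natl mulr2n lerD//; exact: int0.
Qed.

End dyadic_holder.

(** * Almost sure bounds for Gaussian families on the dyadic grid *)

Section dyadic_families.
Context d (T : measurableType d) (R : realType) (Q : probability T R).

Definition root_quarter : R := 2 `^ (- 4^-1).
Local Notation beta := root_quarter.

Lemma root_quarter_gt0 : 0 < beta. Proof. exact: powR_gt0. Qed.

Lemma root_quarter_expn2 n : (beta ^+ n) ^+ 2 = Num.sqrt (2 ^- n).
Proof.
rewrite -powR12_sqrt ?invr_ge0// -powR_invn// -powRrM.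
rewrite -exprM -powR_mulrn ?powR_ge0// -powRrM natrM.
by congr powR; field.
Qed.

(** Up to a constant, the tail at level n beats 4^-(A n), hence the 2^n terms of
    the union. The shape of the right-hand side is that of [epsilon_trick0]: it
    sums over n to O(4^-A). *)
Lemma gaussian_union_bound (c : R) (K A n : nat) : 0 < c -> (0 < A)%N ->
  (K * 2 ^ n)%:R *
    expR (6 - (A%:R * n.+1%:R * beta ^+ n / (10 * (c * beta ^+ n))) ^+ 2)
  <= 2 * K%:R * expR (6 + (5 * c * ln 4) ^+ 2) * 4^-1 ^+ A / (2 ^ n.+1)%:R.
Proof.
move=> c0 A0; have b0 : 0 < beta ^+ n by rewrite exprn_gt0// root_quarter_gt0.
set C0 := expR (6 + _).
have l4 : expR (- ln 4) = 4^-1 :> R by rewrite expRN lnK ?posrE.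
have -> : A%:R * n.+1%:R * beta ^+ n / (10 * (c * beta ^+ n)) =
    (A * n.+1)%:R / (10 * c) :> R.
  by rewrite natrM; field; rewrite ?gt_eqF.
set x := (A * n.+1)%:R.
(* complete the square: (x / 10c)^2 >= x ln 4 - (5 c ln 4)^2 *)
have h1 : expR (6 - (x / (10 * c)) ^+ 2) <= C0 * 4^-1 ^+ (A * n.+1).
  rewrite -l4 -expRM_natl -expRD ler_expR -/x.
  have := sqr_ge0 (x / (10 * c) - 5 * c * ln 4).
  have -> : (x / (10 * c) - 5 * c * ln 4) ^+ 2 =
    (x / (10 * c)) ^+ 2 - x * ln 4 + (5 * c * ln 4) ^+ 2.
    by field; rewrite gt_eqF.
  lra.
have h2 : 4^-1 ^+ (A * n.+1) <= 4^-1 ^+ A * 4^-1 ^+ n :> R.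
  rewrite -exprD; apply: ler_wiXn2l; rewrite ?invr_ge0 ?invf_le1 ?ler1n//.
  by rewrite mulnS leq_add2l leq_pmull.
have C00 : 0 <= C0 by exact: expR_ge0.
have P0 : 0 <= (K * 2 ^ n)%:R :> R by [].
apply: (le_trans (ler_wpM2l P0 h1)).
apply: (le_trans (ler_wpM2l P0 (ler_wpM2l C00 h2))).
rewrite le_eqVlt; apply/predU1P; left.
have -> : 4^-1 ^+ n = (2^-1 ^+ n) * (2^-1 ^+ n) :> R.
  by rewrite -exprMn; congr (_ ^+ _); field.
rewrite natrM !natrX exprS !exprVn.
by field; rewrite !expf_neq0.
Qed.

(** The exceptional event is contained, for every A, in the union over n of the
    events that the bound with this A fails at level n. The probability of that
    union is O(4^-A), which vanishes as A grows. *)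
Lemma dyadic_family_bounded (X : nat -> nat -> T -> R) (K : nat) (c : R) :
  0 < c -> (forall n k, measurable_fun setT (X n k)) ->
  (forall n k (a : R), (k < K * 2 ^ n)%N -> 0 <= a ->
    (Q [set w | (a < `|X n k w|)%R] <=
      (expR (6 - (a / (10 * (c * beta ^+ n))) ^+ 2))%:E)%E) ->
  Q.-negligible (~` [set w | exists A : nat, forall n k, (k < K * 2 ^ n)%N ->
    `|X n k w| <= A%:R * n.+1%:R * beta ^+ n]).
Proof.
move=> c0 mX XQ.
have b0 n : 0 <= beta ^+ n by rewrite exprn_ge0// ltW// root_quarter_gt0.
pose bad A n k := [set w | A%:R * n.+1%:R * beta ^+ n < `|X n k w|].
have mbad A n k : measurable (bad A n k).
  by apply: measurable_lt_set => //; exact: measurableT_comp.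
pose E A n := \big[setU/set0]_(k < K * 2 ^ n) bad A n k.
have mE A n : measurable (E A n) by apply: bigsetU_measurable => k _.
pose eps A : R := 2 * K%:R * expR (6 + (5 * c * ln 4) ^+ 2) * 4^-1 ^+ A.
have QE A n : (0 < A)%N -> (Q (E A n) <= (eps A / (2 ^ n.+1)%:R)%:E)%E.
  move=> A0; apply: (le_trans (Boole_inequality _ _)) => //=.
  pose v := expR
    (6 - (A%:R * n.+1%:R * beta ^+ n / (10 * (c * beta ^+ n))) ^+ 2).
  apply: (@le_trans _ _ (\sum_(k < K * 2 ^ n) v%:E)%E).
    apply: lee_sum => k _; apply: XQ => //.
    by rewrite !mulr_ge0.
  by rewrite sumEFin lee_fin sumr_const card_ord -[v *+ _]mulr_natl;
    exact: gaussian_union_bound.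
pose U A := \bigcup_n E A n.
have mU A : measurable (U A) by exact: bigcup_measurable.
have QU A : (0 < A)%N -> (Q (U A) <= (eps A)%:E)%E.
  move=> A0; apply: (le_trans (generalized_Boole_inequality _ _ _)) => //.
    exact: mU.
  have e0 : 0 <= eps A.
    by rewrite /eps !mulr_ge0// ?expR_ge0// exprn_ge0// invr_ge0.
  apply: (le_trans _ (@epsilon_trick0 _ _ xpredT e0)).
  by apply: lee_nneseries => // n _; exact: QE.
apply: (@negligibleS _ _ _ Q (\bigcap_A U A)).
  move=> w /= /forallNP nw A _.
  have /existsNP[n /existsNP[k]] := nw A.
  move=> /not_implyP[kK /negP]; rewrite -ltNge => wbad.
  exists n => //; rewrite /E -bigcup_mkord; exists k => //.
have mI : measurable (\bigcap_A U A) by exact: bigcapT_measurable.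
apply/negligibleP => //; apply/eqP; rewrite eq_le measure_ge0 andbT.
have Qle A : (0 < A)%N -> (Q (\bigcap_A U A) <= (eps A)%:E)%E.
  by move=> A0; rewrite (le_trans _ (QU A A0))// le_measure ?inE// => w; exact.
rewrite -(fineK (fin_num_measure Q _ mI)) lee_fin.
have eps0 : eps @ \oo --> (0 : R).
  by apply: cvg_geometric; rewrite gtr0_norm ?invr_gt0// invf_lt1// ltr1n.
rewrite -(cvg_lim _ eps0)//; apply: limr_ge; first by apply/cvg_ex; exists 0.
near=> A; have A0 : (0 < A)%N by near: A; exists 1%N.
have := Qle A A0.
by rewrite -lee_fin (fineK (fin_num_measure Q _ mI)).
Unshelve. all: end_near. Qed.

End dyadic_families.

(** * A Kolmogorov continuity theorem for Gaussian increments *)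

Section gaussian_continuity.
Context d (T : measurableType d) (R : realType) (Q : probability T R).
Local Notation beta := (root_quarter R).
Implicit Types (s t gamma : R) (n k K A : nat).

(** Bernoulli's inequality: the ratio 2^(-gamma) / 2^(-1/4) is 1 + h with h > 0,
    and (1 + h)^n grows at least linearly. *)
Lemma linear_geometric_bound gamma : gamma < 4^-1 ->
  exists2 C : R, 0 <= C &
    forall n, n.+1%:R * beta ^+ n <= C * (2 `^ (- gamma)) ^+ n.
Proof.
move=> g4; set theta := 2 `^ (- gamma).
have th0 : 0 < theta by exact: powR_gt0.
pose h := theta / beta - 1.
have b0 := root_quarter_gt0 R.
have h0 : 0 < h.
  rewrite subr_gt0 ltr_pdivlMr// mul1r /theta /root_quarter.
  rewrite -ltr_ln ?posrE ?powR_gt0// !ln_powR ltr_pM2r ?ltrN2//.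
  by rewrite ln_gt0// ltr1n.
exists (1 + h^-1); first by rewrite addr_ge0// invr_ge0 ltW.
move=> n.
have bern : 1 + n%:R * h <= (1 + h) ^+ n.
  elim: n => [|n IH]; first by rewrite mul0r addr0 expr0.
  rewrite exprS -natr1; have n0 : 0 <= n%:R :> R by [].
  have := ler_wpM2l (ltW (ltr_wpDl ler01 h0)) IH; nra.
have hE : theta = (1 + h) * beta by rewrite /h addrC subrK divfK ?gt_eqF.
rewrite hE exprMn mulrA ler_wpM2r ?exprn_ge0 ?(ltW b0)//.
have c0 : 0 <= 1 + h^-1 by rewrite addr_ge0// invr_ge0 ltW.
apply: (le_trans _ (ler_wpM2l c0 bern)).
have -> : (1 + h^-1) * (1 + n%:R * h) = n.+1%:R + (n%:R * h + h^-1).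
  by rewrite -natr1; field; rewrite gt_eqF.
rewrite lerDl; apply: addr_ge0; last by rewrite invr_ge0 ltW.
by apply: mulr_ge0 => //; exact: ltW.
Qed.

Definition mk_rv (f : T -> R) (mf : measurable_fun setT f) : {RV Q >-> R} :=
  HB.pack f (isMeasurableFun.Build _ _ _ _ f mf).

Variable F : R -> {RV Q >-> R}.

Hypothesis F_gauss : forall s t, 0 <= s -> 0 <= t ->
  exists m sigma : R, forall A : set R, measurable A ->
    Q [set w | A (F t w - F s w)] = gauss_law m sigma A.

Hypothesis F_square : forall K, exists2 c : R, 0 < c &
  forall s t, 0 <= s <= K%:R -> 0 <= t <= K%:R ->
  (\int[Q]_w ((F t w - F s w) ^+ 2)%:E <= (c ^+ 2 * Num.sqrt `|t - s|)%:E)%E.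

Let increment_tail K : exists2 c : R, 0 < c &
  forall n s t (a : R), 0 <= s <= K%:R -> 0 <= t <= K%:R ->
  `|t - s| <= 2 ^- n -> 0 <= a -> (Q [set w | (a < `|F t w - F s w|)%R] <=
     (expR (6 - (a / (10 * (c * beta ^+ n))) ^+ 2))%:E)%E.
Proof.
have [c c0 Fc] := F_square K; exists c => // n s t a sK tK tsn a0.
have /andP[s0 _] := sK; have /andP[t0 _] := tK.
have [m [sigma FE]] := F_gauss s0 t0.
apply: (@gauss_law_tail_second_moment _ _ _ Q (F t - F s) m sigma) => //.
  by rewrite mulr_gt0// exprn_gt0// root_quarter_gt0.
apply: (le_trans (Fc s t sK tK)).
rewrite lee_fin exprMn ler_wpM2l ?sqr_ge0// root_quarter_expn2.
by rewrite ler_sqrt// invr_ge0.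
Qed.

Definition good_at K : set T :=
  \bigcup_A \bigcap_n \bigcap_(k in `I_(K * 2 ^ n))
  [set w | `|F (k.+1%:R / 2 ^+ n) w - F (k%:R / 2 ^+ n) w| <=
           A%:R * n.+1%:R * beta ^+ n].

Definition good : set T := \bigcap_K good_at K.

Let measurable_good : measurable good.
Proof.
apply: bigcapT_measurable => K; apply: bigcupT_measurable => A.
apply: bigcapT_measurable => n; apply: bigcap_measurableType => k _.
apply: measurable_le_set => //; apply: measurableT_comp => //.
exact: measurable_funB.
Qed.

Let good_ae : Q.-negligible (~` good).
Proof.
rewrite /good setC_bigcap; apply: negligible_bigcup => K.
have [c c0 Fc] := increment_tail K.
pose X n k w := F (k.+1%:R / 2 ^+ n) w - F (k%:R / 2 ^+ n) w.
have mX n k : measurable_fun setT (X n k) by exact: measurable_funB.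
have XQ n k (a : R) : (k < K * 2 ^ n)%N -> 0 <= a ->
    (Q [set w | (a < `|X n k w|)%R] <=
      (expR (6 - (a / (10 * (c * beta ^+ n))) ^+ 2))%:E)%E.
  have p0 : 0 < 2 ^+ n :> R by rewrite exprn_gt0.
  move=> kK a0; apply: Fc => //.
  - rewrite divr_ge0//= ler_pdivrMr// -natrX -natrM ler_nat.
    exact: ltnW.
  - by rewrite divr_ge0//= ler_pdivrMr// -natrX -natrM ler_nat.
  - by rewrite -mulrBl -natr1 addrAC subrr add0r mul1r ger0_norm// invr_ge0.
apply: negligibleS (dyadic_family_bounded c0 mX XQ).
apply: subsetC => w [A XA]; exists A => // n _ k /= kK; exact: XA.
Qed.

Let good_geometric w K gamma : good w -> gamma < 4^-1 ->
  exists2 C, 0 <= C & forall n k, (k < K * 2 ^ n)%N ->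
  `|F (k.+1%:R / 2 ^+ n) w - F (k%:R / 2 ^+ n) w| <= C * (2 `^ (- gamma)) ^+ n.
Proof.
move=> /(_ K I) [A _ wA] /linear_geometric_bound[C C0 CE].
exists (A%:R * C); first exact: mulr_ge0.
move=> n k kK; apply: (le_trans (wA n I k kK)).
by rewrite -!mulrA ler_wpM2l// CE.
Qed.

Let rate_itv gamma : 0 < gamma -> 0 < (2 : R) `^ (- gamma) < 1.
Proof.
move=> g0; rewrite powR_gt0//= -ltr_ln ?posrE ?powR_gt0//.
by rewrite ln1 ln_powR mulNr oppr_lt0 mulr_gt0// ln_gt0// ltr1n.
Qed.

(** Off the good event the path is identically 0, so that the Hoelder property
    holds for every outcome; the absolute value makes the limit exist at every
    real time. *)
Definition path w t : R :=
  if w \in good then dyadic_lim (fun r => F r w) `|t| else 0.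

Lemma good_cvg w t : good w -> 0 <= t ->
  (fun n => F (dyadic_floor t n) w) @ \oo --> dyadic_lim (fun r => F r w) t.
Proof.
move=> wgood t0; have g8 : 8^-1 < 4^-1 :> R by rewrite ltf_pV2 ?posrE// ltr_nat.
have [C C0 wC] := good_geometric (Num.truncn t).+1 wgood g8.
apply: (cvg_dyadic_lim _ C0 wC); first exact: rate_itv.
by rewrite t0 ltW// truncnS_gt.
Qed.

Let measurable_path t : measurable_fun setT (path ^~ t).
Proof.
apply: (@measurable_fun_cvg _ _ _ setT
  (fun n w => \1_good w * F (dyadic_floor `|t| n) w)) => [n|w _].
  by apply: measurable_funM => //; exact: measurable_indic.
rewrite /path; case: ifPn => [/set_mem wg|wg].
  rewrite indicE mem_set//; under eq_fun do rewrite mul1r.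
  exact: good_cvg.
rewrite indicE (negbTE wg); under eq_fun do rewrite mul0r.
exact: cvg_cst.
Qed.

Let path_holder gamma w : 0 < gamma < 4^-1 -> locally_holder gamma (path w).
Proof.
move=> /andP[g0 g4] M M0; rewrite /path.
case: (boolP (w \in good)) => [/set_mem wg|_]; last first.
  by exists 0 => s t _ _; rewrite subrr normr0 mul0r.
have [C C0 wC] := good_geometric (Num.truncn M).+1 wg g4.
have [C' HC'] := @dyadic_lim_holder R (fun r => F r w) _ _ C (rate_itv g0) C0
  wC gamma g0 erefl.
have MK r : 0 <= r <= M -> 0 <= r <= (Num.truncn M).+1%:R.
  by move=> /andP[-> rM]/=; rewrite (le_trans rM)// ltW// truncnS_gt.
exists C' => s t sM tM; have /andP[s0 _] := sM; have /andP[t0 _] := tM.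
by rewrite (ger0_norm s0) (ger0_norm t0); apply: HC'; exact: MK.
Qed.

(* F at the dyadic approximations of t tends to F t almost surely: the family
   of differences, with one member per level, obeys the same tail bounds *)
Let path_modification t : 0 <= t -> Q.-negligible [set w | path w t <> F t w].
Proof.
move=> t0; have [c c0 Fc] := increment_tail (Num.truncn t).+1.
pose X n (k : nat) w := F (dyadic_floor t n) w - F t w.
have mX n k : measurable_fun setT (X n k) by exact: measurable_funB.
have XQ n k (a : R) : (k < 1 * 2 ^ n)%N -> 0 <= a ->
    (Q [set w | (a < `|X n k w|)%R] <=
      (expR (6 - (a / (10 * (c * beta ^+ n))) ^+ 2))%:E)%E.
  have /andP[h1 h2] := dyadic_floor_itv n t0.
  move=> _ a0; apply: Fc => //.
  - by rewrite t0 ltW// truncnS_gt.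
  - by rewrite divr_ge0//= (le_trans h1)// ltW// truncnS_gt.
  - by rewrite distrC ger0_norm ?subr_ge0// lerBlDl ltW.
apply: negligibleS (negligibleU good_ae (dyadic_family_bounded c0 mX XQ)).
move=> w /= pathF; apply: contrapT => /not_orP[/contrapT wg /contrapT[A XA]].
apply: pathF; rewrite /path mem_set// ger0_norm//.
have Ft := good_cvg wg t0.
have g8 : 8^-1 < 4^-1 :> R by rewrite ltf_pV2 ?posrE// ltr_nat.
have [C C0 linC] := linear_geometric_bound g8.
have e8 : 0 < 8^-1 :> R by rewrite invr_gt0.
have /andP[r0 r1] := rate_itv e8.
apply: (cvg_unique _ Ft) => //; apply/subr_cvg0.
apply: (@squeeze_cvgr _ _ _ _
  (fun n => - (A%:R * C * (2 `^ (- 8^-1)) ^+ n))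
  (fun n => A%:R * C * (2 `^ (- 8^-1)) ^+ n)).
- apply: nearW => n; rewrite -ler_norml.
  apply: (le_trans (XA n 0%N _)); first by rewrite mul1n expn_gt0.
  by rewrite -!mulrA ler_wpM2l// linC.
- rewrite -[0]oppr0; apply: cvgN; apply: cvg_geometric.
  by rewrite gtr0_norm.
- apply: cvg_geometric.
  by rewrite gtr0_norm.
Qed.

Theorem gaussian_holder_modification : exists G : R -> {RV Q >-> R},
  modification F G /\
  forall gamma, 0 < gamma < 4^-1 ->
    forall w, locally_holder gamma (fun t => G t w).
Proof.
exists (fun t => mk_rv (measurable_path t)); split; last first.
  by move=> gamma g04 w; exact: path_holder.
move=> t t0 /=.
have mE : measurable [set w | path w t = F t w].
  have -> : [set w | path w t = F t w] =
      [set w | path w t <= F t w] `&` [set w | F t w <= path w t].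
    apply/seteqP; split => w /= => [->//|[h1 h2]].
    by apply/eqP; rewrite eq_le h1.
  by apply: measurableI; exact: measurable_le_set.
have /negligibleP := path_modification t0.
have -> : [set w | path w t <> F t w] = ~` [set w | path w t = F t w] by [].
move=> /(_ (measurableC mE)) QC.
by rewrite -[X in Q X]setCK probability_setC ?QC ?sube0//; exact: measurableC.
Qed.

End gaussian_continuity.

(** * Conditioning on an independent sigma-algebra *)

Section independent_interval.
Context d (T : measurableType d) (R : realType) (P : probability T R).
Variables (X : {RV P >-> R}) (G : set (set T)).
Hypothesis G_measurable : G `<=` measurable.
Hypothesis X_indep :
  independent_sigma P (preimage_set_system setT X measurable) <<s G >>.

(* the sample space, seen with the sigma-algebra generated by G only *)
Local Notation S := (g_sigma_algebraType G).

Let sub_measurable (A : set T) : <<s G >> A -> measurable A.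
Proof. by apply: smallest_sub => //; exact: sigma_algebra_measurable. Qed.

Let toS (w : T) : S := w.

Let measurable_toS : measurable_fun setT toS.
Proof. by move=> _ A mA; rewrite setTI; exact: sub_measurable. Qed.

Let toS_rv : {mfun T >-> S} :=
  HB.pack toS (isMeasurableFun.Build _ _ _ _ _ measurable_toS).

Let joint (w : T) : S * R := (toS w, X w).

Let measurable_joint : measurable_fun setT joint.
Proof. exact: measurable_fun_pair. Qed.

Let joint_rv : {mfun T >-> (S * R)%type} :=
  HB.pack joint (isMeasurableFun.Build _ _ _ _ _ measurable_joint).

(** Independence says that the joint law of X and of the outcome, seen through
    the sigma-algebra of G, is a product measure; Fubini then freezes the
    endpoints Y and Z. Taking the whole sigma-algebra as the second factor
    avoids treating one by one the random vectors from which Y and Z are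
    built. *)
Lemma independent_itv (Y Z : S -> R) :
  measurable_fun setT Y -> measurable_fun setT Z ->
  measurable_fun setT
    (fun w : T => distribution P X `]Y w, Z w]%classic) /\
  (P [set w | (Y w < X w <= Z w)%R] =
    \int[P]_w distribution P X `]Y w, Z w]%classic)%E.
Proof.
move=> mY mZ.
pose E : set (S * R) := [set z | Y z.1 < z.2] `&` [set z | z.2 <= Z z.1].
have mE : measurable E.
  apply: measurableI.
    by apply: measurable_lt_set => //; exact: measurableT_comp.
  by apply: measurable_le_set => //; exact: measurableT_comp.
have mphi := measurable_fun_xsection (distribution P X) mE.
have sectionE (w : S) : xsection E w = `]Y w, Z w]%classic.
  apply/seteqP; split=> x; rewrite /xsection/= in_itv/= inE /E/=.
    by move=> [-> ->].
  by move=> /andP[].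
have phiE : (fun w : S => distribution P X (xsection E w)) =
    (fun w => distribution P X `]Y w, Z w]%classic).
  by apply/funext => w; rewrite sectionE.
split.
  have := measurableT_comp mphi measurable_toS.
  by rewrite /comp/= phiE.
have prodE := @product_measure_unique _ _ S R R (distribution P toS_rv)
  (distribution P X) (distribution P joint_rv).
transitivity (distribution P joint_rv E).
  congr (P _); apply/seteqP; split=> w /=; first by move=> /andP[].
  by move=> [h1 h2]; apply/andP.
rewrite -prodE//; last first.
  move=> A C mA mC /=; rewrite muleC.
  transitivity (P (X @^-1` C `&` A)); last first.
    by apply: X_indep => //; exists C => //; rewrite setTI.
  by congr (P _); apply/seteqP; split=> w /= [].
rewrite /product_measure1/= ge0_integral_distribution//.
by apply: eq_integral => w _ /=; rewrite sectionE.
Qed.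

End independent_interval.

(** * Laws of short intervals and densities *)

Section density_interval.
Variable R : realType.
Implicit Types (mu : set R -> \bar R) (g : R -> R) (a b h L : R).

Let is_density_itv mu g a b : is_density mu g ->
  mu `]a, b]%classic = (\int[lebesgue_measure]_(x in `]a, b]) (g x)%:E)%E.
Proof. by move=> [_ _ ->]//; exact: measurable_itv. Qed.

Let integral_cst_itv a b (M : R) : a <= b ->
  (\int[lebesgue_measure]_(x in `]a, b]) M%:E)%E = (M * (b - a))%:E.
Proof.
move=> ab; rewrite integral_cst//= lebesgue_measure_itv/= lte_fin.
case: ltP => [_|ba]; first by rewrite -EFinB -EFinM.
have -> : a = b by apply/eqP; rewrite eq_le ab.
by rewrite mule0 subrr mulr0.
Qed.

Lemma density_itv_le mu g a b (M : R) : is_density mu g -> a <= b ->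
  (forall x, a < x <= b -> g x <= M) ->
  (mu `]a, b]%classic <= (M * (b - a))%:E)%E.
Proof.
move=> dg ab gM; rewrite (is_density_itv _ _ dg) -integral_cst_itv//.
case: dg => mg g0 _; apply: ge0_le_integral => //=.
- by move=> x _; rewrite lee_fin.
- exact/measurable_funTS/measurable_EFinP.
Qed.

Lemma density_itv_ge mu g a b (M : R) : is_density mu g -> a <= b -> 0 <= M ->
  (forall x, a < x <= b -> M <= g x) ->
  ((M * (b - a))%:E <= mu `]a, b]%classic)%E.
Proof.
move=> dg ab M0 gM; rewrite (is_density_itv _ _ dg) -integral_cst_itv//.
case: dg => mg g0 _; apply: ge0_le_integral => //=.
- exact/measurable_funTS/measurable_EFinP.
Qed.

(** Both masses are within L h^2 of h times the value of g at the left end. *)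
Lemma density_itv_shift mu g a b h L : is_density mu g -> 0 <= h -> 0 <= L ->
  (forall x y, `|g x - g y| <= L * `|x - y|) ->
  (mu `]a, (a + h)%R]%classic <=
   mu `]b, (b + h)%R]%classic + (h * (L * `|a - b| + 2 * L * h))%:E)%E.
Proof.
move=> dg h0 L0 gL.
have ah : a <= a + h by rewrite lerDl.
have bh : b <= b + h by rewrite lerDl.
have width x : x + h - x = h by rewrite addrC addKr.
have close x y : x < y <= x + h -> `|g y - g x| <= L * h.
  move=> /andP[xy yx]; apply: (le_trans (gL _ _)); rewrite ler_wpM2l//.
  by rewrite gtr0_norm ?subr_gt0// lerBlDl.
have up : (mu `]a, (a + h)%R]%classic <= ((g a + L * h) * h)%:E)%E.
  rewrite -{3}(width a); apply: density_itv_le dg ah _ => x /close.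
  by rewrite ler_norml; lra.
(* a negative lower bound for the density gives nothing: use mu >= 0 *)
have down : (((g b - L * h) * h)%:E <= mu `]b, (b + h)%R]%classic)%E.
  have [neg|pos] := ltP (g b - L * h) 0.
    apply: (@le_trans _ _ 0%E); first by rewrite lee_fin; nra.
    rewrite (is_density_itv _ _ dg); apply: integral_ge0 => x _.
    by rewrite lee_fin; case: dg.
  rewrite -{2}(width b); apply: density_itv_ge dg bh pos _ => x /close.
  by rewrite ler_norml; lra.
apply: (le_trans up); apply: (le_trans _ (leeD down (lexx _))).
rewrite -EFinD lee_fin; have := gL a b; rewrite ler_norml => /andP[_ gab].
by nra.
Qed.

Lemma density_itv_value mu g x (e : R) : is_density mu g -> continuous g ->
  0 < e -> exists2 h0 : R, 0 < h0 & forall h, 0 < h <= h0 ->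
  (((g x - e) * h)%:E <= mu `]x, (x + h)%R]%classic)%E /\
  (mu `]x, (x + h)%R]%classic <= ((g x + e) * h)%:E)%E.
Proof.
move=> dg cg e0.
have /cvgr_dist_lt/(_ e e0)/nbhs_ballP[r /= r0 gr] := cg x.
exists (r / 2); first by rewrite divr_gt0.
move=> h /andP[h0 hr].
have xh : x <= x + h by rewrite lerDl ltW.
have width : x + h - x = h by rewrite addrC addKr.
have close y : x < y <= x + h -> `|g x - g y| < e.
  move=> /andP[xy yx]; apply: gr; rewrite /ball/= distrC gtr0_norm ?subr_gt0//.
  lra.
split; last first.
  rewrite -{2}width; apply: density_itv_le dg xh _ => y /close.
  by rewrite ltr_norml; lra.
have [neg|pos] := ltP (g x - e) 0.
  apply: (@le_trans _ _ 0%E); first by rewrite lee_fin; nra.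
  rewrite (is_density_itv _ _ dg); apply: integral_ge0 => y _.
  by rewrite lee_fin; case: dg.
rewrite -{1}width; apply: density_itv_ge dg xh pos _ => y /close.
by rewrite ltr_norml; lra.
Qed.

Lemma continuous_density_unique mu g1 g2 :
  is_density mu g1 -> is_density mu g2 -> continuous g1 -> continuous g2 ->
  g1 = g2.
Proof.
suff half (g h : R -> R) : is_density mu g -> is_density mu h -> continuous g ->
    continuous h -> forall x, g x <= h x.
  by move=> d1 d2 c1 c2; apply/funext => x; apply/eqP; rewrite eq_le !half.
move=> dg dh cg ch x; apply/ler_addgt0Pr => e e0.
have e2 : 0 < e / 2 by rewrite divr_gt0.
have [h1 h10 H1] := density_itv_value x dg cg e2.
have [h2 h20 H2] := density_itv_value x dh ch e2.
have r0 : 0 < Num.min h1 h2 by rewrite lt_min h10.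
have H1r : 0 < Num.min h1 h2 <= h1 by rewrite r0 ge_min lexx.
have H2r : 0 < Num.min h1 h2 <= h2 by rewrite r0 ge_min lexx orbT.
have [lo _] := H1 _ H1r; have [_ hi] := H2 _ H2r; have := le_trans lo hi.
by rewrite lee_fin ler_pM2r//; lra.
Qed.

Lemma gauss_law_itv_gt0 m s a b : s != 0 -> a < b ->
  (0 < gauss_law m s `]a, b]%classic)%E.
Proof.
move=> s0 ab; rewrite /gauss_law (negbTE s0).
have dg : is_density (normal_prob m s) (normal_pdf m s).
  split=> //; first exact: measurable_normal_pdf.
  exact: normal_pdf_ge0.
pose M := `|a - m| + `|b - m|.
pose c := normal_peak s * expR (- M ^+ 2 / (s ^+ 2 *+ 2)).
have c0 : 0 < c by rewrite mulr_gt0 ?normal_peak_gt0// expR_gt0.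
apply: (@lt_le_trans _ _ (c * (b - a))%:E).
  by rewrite lte_fin mulr_gt0// subr_gt0.
apply: (density_itv_ge dg); rewrite ?ltW// => x /andP[ax xb].
rewrite normal_pdfE// /c ler_wpM2l ?normal_peak_ge0// ler_expR.
rewrite ler_wpM2r ?invr_ge0 ?mulrn_wge0 ?sqr_ge0// lerN2.
rewrite -[leLHS]real_normK ?num_real// ler_sqr ?nnegrE ?addr_ge0//.
rewrite ler_norml /M; have := ler_norm (b - m); have := ler_norm (- (a - m)).
rewrite normrN; have := normr_ge0 (a - m); have := normr_ge0 (b - m); lra.
Qed.

End density_interval.

(** * Brownian motion started from a smooth density *)

Section brownian_quantiles.
Context d (Omega : measurableType d) (R : realType) (P : probability Omega R).
Variables (B W : R -> {RV P >-> R}) (f : R -> R) (u : R -> R -> R) (K L : R).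
Hypothesis W_brownian : standard_brownian_motion W.
Hypothesis BE : forall w t, 0 <= t -> B t w = B 0 w + W t w.
Hypothesis B0_indep : independent_sigma P
  (preimage_set_system setT (B 0) measurable) (process_sigma W).
Hypothesis B0_density : is_density (distribution P (B 0)) f.
Hypothesis f_le : forall x, f x <= K.
Hypothesis L_gt0 : 0 < L.
Hypothesis f_lip : forall x y, `|f x - f y| <= L * `|x - y|.
Hypothesis u_density : forall t, 0 <= t ->
  is_density (distribution P (B t)) (fun x => u x t) /\
  continuous (fun x => u x t).

Local Notation law0 := (distribution P (B 0)).
Local Notation generators := (\bigcup_(t in [set t : R | 0 <= t])
  preimage_set_system setT (W t) measurable).
Local Notation S := (g_sigma_algebraType generators).

Let generators_measurable : generators `<=` measurable.
Proof.
move=> A [t t0 [C mC <-]]; rewrite setTI.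
exact: measurable_funPTI.
Qed.

Let measurable_W t : 0 <= t -> measurable_fun setT (W t : S -> R).
Proof.
move=> t0 _ C mC; apply: sub_sigma_algebra; exists t => //.
by exists C.
Qed.

Lemma brownian_increment_abs s t : 0 <= s -> 0 <= t ->
  (\int[P]_w (`|W t w - W s w|)%:E <= (2 * Num.sqrt `|t - s|)%:E)%E.
Proof.
wlog st : s t / s <= t.
  move=> th s0 t0; have [st|/ltW ts] := leP s t; first exact: th.
  rewrite distrC; apply: le_trans (th t s ts t0 s0).
  by under eq_integral do rewrite distrC.
move=> s0 t0; rewrite ger0_norm ?subr_ge0//.
apply: (@gauss_law0_expectation_abs _ _ _ P (W t - W s)) => //.
move=> A mA.
have -> : [set w | A ((W t - W s) w)] = [set w | A (W t w - W s w)] by [].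
by rewrite (bm_gaussian_increments W_brownian s0 st mA).
Qed.

(* Given W, both conditions on B are conditions on B 0. *)
Let B0_between (x y s t : R) : 0 <= s -> 0 <= t ->
  measurable_fun setT
    (fun w => law0 `]x - W t w, y - W s w]%classic) /\
  (P [set w | (x < B t w)%R /\ (B s w <= y)%R] =
   \int[P]_w law0 `](x - W t w)%R, (y - W s w)%R]%classic)%E.
Proof.
move=> s0 t0.
have mY : measurable_fun setT (fun w : S => x - W t w).
  by apply: measurable_funB => //; exact: measurable_W.
have mZ : measurable_fun setT (fun w : S => y - W s w).
  by apply: measurable_funB => //; exact: measurable_W.
have [m12 <-] := independent_itv generators_measurable B0_indep mY mZ.
split=> //; congr (P _); apply/seteqP; split=> w /=.
  by rewrite (BE _ s0) (BE _ t0) => -[h1 h2]; rewrite ltrBlDr lerBrDr h1 h2.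
by rewrite (BE _ s0) (BE _ t0) ltrBlDr lerBrDr => /andP[].
Qed.

Let density_K_ge0 : 0 <= K.
Proof. by case: B0_density => _ f0 _; exact: le_trans (f0 0) (f_le 0). Qed.

(** The frozen interval for B 0 has length at most |x - y| + |W t - W s|, and
    the density of B 0 is at most K. *)
Lemma crossing_bound x y s t : 0 <= s -> 0 <= t ->
  (P [set w | (x < B t w)%R /\ (B s w <= y)%R] <=
   (K * (`|x - y| + 2 * Num.sqrt `|t - s|))%:E)%E.
Proof.
move=> s0 t0; have [m12 ->] := B0_between x y s0 t0.
have mI : measurable_fun setT (fun w => (`|W t w - W s w|)%:E).
  apply/measurable_EFinP; apply: measurableT_comp => //.
  exact: measurable_funB.
apply: (@le_trans _ _
  (\int[P]_w (K%:E * (`|x - y|%:E + (`|W t w - W s w|)%:E))%E)%E).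
  apply: ge0_le_integral => //=.
  - apply: emeasurable_funM => //; exact: emeasurable_funD.
  - move=> w _; have [zy|yz] := leP (x - W t w) (y - W s w).
      apply: (le_trans (@density_itv_le _ _ f _ _ K B0_density zy _)) => //.
      rewrite -EFinD -EFinM lee_fin ler_wpM2l//.
      have -> : y - W s w - (x - W t w) = (y - x) + (W t w - W s w) by ring.
      by rewrite distrC lerD// ler_norm.
    rewrite set_itv_ge ?measure0//; last by rewrite bnd_simp -leNgt ltW.
    by rewrite -EFinD -EFinM lee_fin mulr_ge0// addr_ge0.
rewrite ge0_integralZl//=; last 2 first.
  - exact: emeasurable_funD.
  - by move=> w _; rewrite -EFinD lee_fin addr_ge0.
rewrite EFinM lee_wpmul2l ?lee_fin//.
rewrite ge0_integralD//= integral_cst//= [P _]probability_setT mule1 EFinD.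
rewrite leeD2l//.
exact: brownian_increment_abs.
Qed.

Let law_itv x h t : 0 <= t ->
  distribution P (B t) `]x, (x + h)%R]%classic =
  (\int[P]_w law0 `](x - W t w)%R, (x + h - W t w)%R]%classic)%E.
Proof.
move=> t0; have [_ <-] := B0_between x (x + h) t0 t0.
congr (P _); apply/seteqP; split=> w /=; rewrite in_itv/=.
  by move=> /andP[].
by move=> [-> ->].
Qed.

Let law_shift x y h s t : 0 <= s -> 0 <= t -> 0 < h ->
  (distribution P (B t) `]x, (x + h)%R]%classic <=
   distribution P (B s) `]y, (y + h)%R]%classic +
   (h * (L * (`|x - y| + 2 * Num.sqrt `|t - s|) + 2 * L * h))%:E)%E.
Proof.
move=> s0 t0 h0; rewrite !law_itv//.
have [mt _] := B0_between x (x + h) t0 t0.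
have [ms _] := B0_between y (y + h) s0 s0.
have mI : measurable_fun setT (fun w => (`|W t w - W s w|)%:E).
  apply/measurable_EFinP; apply: measurableT_comp => //.
  exact: measurable_funB.
pose C := h * (L * `|x - y| + 2 * L * h).
have L0 := ltW L_gt0; have h0' := ltW h0.
have hL0 : 0 <= h * L by exact: mulr_ge0.
have C0 : 0 <= C by rewrite mulr_ge0// addr_ge0// !mulr_ge0.
apply: (@le_trans _ _ (\int[P]_w
  (law0 `](y - W s w)%R, (y + h - W s w)%R]%classic +
   (C%:E + (h * L)%:E * (`|W t w - W s w|)%:E))%E)%E).
  apply: ge0_le_integral => //=.
  - apply: emeasurable_funD => //; apply: emeasurable_funD => //.
    exact: emeasurable_funM.
  - move=> w _; rewrite -[x + h - _]addrAC -[y + h - _]addrAC.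
    apply: (le_trans (density_itv_shift (x - W t w) (y - W s w)
      B0_density _ L0 f_lip)) => //.
    rewrite leeD2l// -EFinM -EFinD lee_fin /C.
    have : `|x - W t w - (y - W s w)| <= `|x - y| + `|W t w - W s w|.
      have -> : x - W t w - (y - W s w) = (x - y) - (W t w - W s w) by ring.
      exact: ler_normB.
    move=> /(ler_wpM2l hL0); set c := `|_|; set a := `|_|; set b := `|_|; lra.
rewrite ge0_integralD//=; last 2 first.
  - by move=> w _; rewrite -EFinM -EFinD lee_fin addr_ge0// mulr_ge0.
  - by apply: emeasurable_funD => //; exact: emeasurable_funM.
rewrite leeD2l// ge0_integralD//=; last 2 first.
  - by move=> w _; rewrite -EFinM lee_fin mulr_ge0.
  - exact: emeasurable_funM.
rewrite integral_cst//= [P _]probability_setT mule1 ge0_integralZl//=.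
have := brownian_increment_abs s0 t0.
move=> /(lee_wpmul2l (_ : 0 <= (h * L)%:E)%E) => /(_ _)/(leeD2l C%:E) le.
apply: (le_trans (le _)); first by rewrite lee_fin.
by rewrite -EFinM -EFinD lee_fin /C; lra.
Qed.

(** The law of B t is a mixture of translates of the law of B 0. Moving from
    (x, t) to (y, s) displaces each translate by at most |x - y| + |W t - W s|,
    which changes the mass of an interval of length h by at most
    L h (|x - y| + |W t - W s|) + 2 L h^2; divide by h and let h tend to 0. *)
Lemma density_lipschitz x y s t : 0 <= s -> 0 <= t ->
  `|u x t - u y s| <= L * (`|x - y| + 2 * Num.sqrt `|t - s|).
Proof.
move=> s0 t0.
wlog suff half : x y s t s0 t0 /
    u x t <= u y s + L * (`|x - y| + 2 * Num.sqrt `|t - s|).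
  have h1 := half x y s t s0 t0; have h2 := half y x t s t0 s0.
  by rewrite distrC [`|s - t|]distrC in h2; rewrite ler_norml; lra.
apply/ler_addgt0Pr => e e0; set D := L * _.
have e4 : 0 < e / 4 by rewrite divr_gt0.
have [dt ct] := u_density t0; have [ds cs] := u_density s0.
have [h1 h10 H1] := density_itv_value x dt ct e4.
have [h2 h20 H2] := density_itv_value y ds cs e4.
pose h := Num.min (Num.min h1 h2) (e / (8 * L)).
have hh1 : h <= h1 by rewrite !ge_min lexx.
have hh2 : h <= h2 by rewrite !ge_min lexx orbT.
have h0 : 0 < h by rewrite !lt_min h10 h20 divr_gt0// mulr_gt0.
have hL : 2 * L * h <= e / 4.
  have : h <= e / (8 * L) by rewrite ge_min lexx orbT.
  rewrite ler_pdivlMr ?mulr_gt0//; lra.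
have H1h : 0 < h <= h1 by rewrite h0.
have H2h : 0 < h <= h2 by rewrite h0.
have [lo _] := H1 h H1h; have [_ hi] := H2 h H2h.
have := le_trans lo (law_shift x y s0 t0 h0).
move=> /le_trans /(_ (leeD hi (lexx _))); rewrite -EFinD lee_fin -/D.
rewrite [h * _]mulrC -mulrDl ler_pM2r//; lra.
Qed.

(** With positive probability x - W t is close to q0, and then B 0 has a density
    of at least f q0 / 2 around that point. *)
Lemma density_gt0 x t q0 : 0 < t -> 0 < f q0 -> 0 < u x t.
Proof.
move=> t0 fq0; have t0' := ltW t0.
(* f >= c on the ball of radius 2 r around q0 *)
pose r := f q0 / (4 * L); pose c := f q0 / 2.
have r0 : 0 < r by rewrite divr_gt0// mulr_gt0.
have rE : 2 * L * r = c by rewrite /r /c; field; rewrite gt_eqF.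
have c0 : 0 < c by rewrite divr_gt0.
pose A := [set w | q0 < x - W t w <= q0 + r].
have mW : measurable_fun setT (fun w => x - W t w) by exact: measurable_funB.
have mA : measurable A.
  have -> : A = [set w | q0 < x - W t w] `&` [set w | x - W t w <= q0 + r].
    by apply/seteqP; split=> w; [move=> /andP[]|move=> [? ?]; exact/andP].
  by apply: measurableI; [exact: measurable_lt_set|exact: measurable_le_set].
have PA : (0 < P A)%E.
  pose A' := [set w | `]x - q0 - r, x - q0 - r / 2]%classic (W t w - W 0 w)].
  have mA' : measurable A'.
    have mWW : measurable_fun setT (fun w => W t w - W 0 w).
      exact: measurable_funB.
    by rewrite -[A']setTI; apply: mWW => //; exact: measurable_itv.
  have PA' : (0 < P A')%E.
    rewrite /A' (bm_gaussian_increments W_brownian (lexx 0) t0')//.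
    rewrite subr0; apply: gauss_law_itv_gt0; last by lra.
    by rewrite gt_eqF// sqrtr_gt0.
  have [N [mN PN NW]] := bm_start W_brownian.
  apply: (lt_le_trans PA'); apply: (@le_trans _ _ (P (A `|` N))).
    rewrite le_measure ?inE//; first exact: measurableU.
    move=> w; rewrite /A'/A/= in_itv/= => wA.
    have [W0|W0] := pselect (W 0 w = 0); last by right; exact: NW.
    left; rewrite W0 subr0 in wA; move: wA => /andP[? ?].
    by apply/andP; split; lra.
  by rewrite (le_trans (measureU2 _ _ _))// [X in (_ + X)%E]PN adde0.
have [dt ct] := u_density t0'.
have pE := fineK (fin_num_measure P A mA).
have p0 : 0 < fine (P A) by rewrite -lte_fin pE.
set p := fine (P A) in pE p0.
have cp0 : 0 < c * p by exact: mulr_gt0.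
have cp2 : 0 < c * p / 2 by exact: divr_gt0.
have [h1 h10 H] := density_itv_value x dt ct cp2.
pose h := Num.min h1 r.
have h0 : 0 < h by rewrite lt_min h10.
have hr : h <= r by rewrite ge_min lexx orbT.
have Hh : 0 < h <= h1 by rewrite h0 ge_min lexx.
have [_ hi] := H h Hh.
have lo : ((c * h)%:E * P A <= distribution P (B t) `]x, (x + h)%R]%classic)%E.
  rewrite law_itv//; have [mt _] := B0_between x (x + h) t0' t0'.
  have ch0 : 0 <= c * h by rewrite mulr_ge0// ltW.
  rewrite -[P A](_ : (\int[P]_w (\1_A w)%:E)%E = _); last first.
    by rewrite integral_indic// setIT.
  rewrite -ge0_integralZl//; last exact/measurable_EFinP/measurable_indic.
  apply: ge0_le_integral => //=.
  - by move=> w _; rewrite -EFinM lee_fin mulr_ge0.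
  - by apply: emeasurable_funM => //; exact/measurable_EFinP/measurable_indic.
  - move=> w _; rewrite indicE.
    have [/set_mem/andP[qx xq]|_] := boolP (w \in A); last by rewrite mule0.
    rewrite mule1 (_ : c * h = c * ((x + h - W t w) - (x - W t w))); last first.
      by ring.
    apply: (density_itv_ge B0_density); rewrite ?(ltW c0)//; first by lra.
    move=> z /andP[xz zx]; have := f_lip z q0.
    have zq : `|z - q0| <= 2 * r by rewrite gtr0_norm; lra.
    move=> /le_trans /(_ (ler_wpM2l (ltW L_gt0) zq)).
    by rewrite mulrCA mulrA rE ler_norml /c; lra.
have := le_trans lo hi; rewrite -pE -EFinM lee_fin mulrAC ler_pM2r//; lra.
Qed.

(** * The motion of the quantile *)

Variables (alpha : R) (q : R -> R).
Hypothesis alpha01 : 0 < alpha < 1.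
Hypothesis q_quantile :
  forall t, 0 <= t -> P [set w | (B t w <= q t)%R] = alpha%:E.
Hypothesis f_continuous : continuous f.
Hypothesis f_q0_gt0 : 0 < f (q 0).

Local Notation v t := (u (q t) t).
Local Notation rho := (quantile_covariance alpha B q u).

Lemma quantile_density_gt0 t : 0 <= t -> 0 < v t.
Proof.
rewrite le_eqVlt => /predU1P[<-|t0]; last exact: density_gt0 f_q0_gt0.
have [d0 c0] := u_density (lexx 0).
rewrite -[u (q 0) 0]/((fun x => u x 0) (q 0)).
by rewrite (continuous_density_unique d0 B0_density).
Qed.

Let p t x := fine (P [set w | B t w <= x]).

Let measurable_B_le t x : measurable [set w | B t w <= x].
Proof. exact: measurable_le_set. Qed.

Let pE t x : P [set w | B t w <= x] = (p t x)%:E.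
Proof. by rewrite fineK// fin_num_measure. Qed.

Let measurable_crossing s t x y :
  measurable [set w | (x < B t w)%R /\ (B s w <= y)%R].
Proof.
by apply: measurableI; [exact: measurable_lt_set|exact: measurable_le_set].
Qed.

Let p_time s t x : 0 <= s -> 0 <= t ->
  p t x <= p s x + 2 * K * Num.sqrt `|t - s|.
Proof.
move=> s0 t0; rewrite -lee_fin EFinD -!pE.
have := crossing_bound x x t0 s0; rewrite subrr normr0 add0r [`|s - t|]distrC.
rewrite mulrCA mulrA => /(leeD2l (P [set w | B s w <= x])); apply: le_trans.
apply: (le_trans _ (measureU2 _ _ _)) => //.
rewrite le_measure ?inE//; first exact: measurableU.
by move=> w /= Bt; have [|xB] := leP (B s w) x; [left|right].
Qed.

Let p_slope t a b (m : R) : 0 <= t -> a <= b -> 0 <= m ->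
  (forall x, a < x <= b -> m <= u x t) -> m * (b - a) <= p t b - p t a.
Proof.
move=> t0 ab m0 um; have [dt _] := u_density t0.
have := density_itv_ge dt ab m0 um.
have -> : distribution P (B t) `]a, b]%classic =
    P ([set w | B t w <= b] `\` [set w | B t w <= a]).
  congr (P _); apply/seteqP; split=> w /=; rewrite in_itv/=.
    by move=> /andP[aB ->]; split=> //; rewrite leNgt aB.
  by move=> [-> /negP]; rewrite -ltNge => ->.
have Bb_lty : (P [set w | (B t w <= b)%R] < +oo)%E by rewrite pE ltry.
rewrite measureD//.
rewrite (_ : _ `&` _ = [set w | B t w <= a]); last first.
  apply/seteqP; split=> w /= => [[]//|Ba]; split=> //; exact: le_trans ab.
by rewrite [X in (_ <= X - _)%E]pE [X in (_ <= _ - X)%E]pE -EFinB lee_fin.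
Qed.

Let p_quantile t : 0 <= t -> p t (q t) = alpha.
Proof. by move=> t0; rewrite /p q_quantile. Qed.

(** By [density_lipschitz] the density of B t is at least v t / 2 on the window
    of radius v t / (2 L) around q t. So the left-hand side is a lower bound
    for the mass that the law of B t gives to the part of the window between q t
    and q s, while the whole mass between them is the change in time of the
    distribution function at q s. The minimum makes the statement free of any
    a priori control on q s - q t. *)
Lemma quantile_displacement s t : 0 <= s -> 0 <= t ->
  Num.min `|q s - q t| (v t / (2 * L)) * (v t / 2) <= 2 * K * Num.sqrt `|t - s|.
Proof.
move=> s0 t0; have v0 := quantile_density_gt0 t0.
set l := Num.min _ _.
have l0 : 0 <= l by rewrite le_min normr_ge0/= ltW// divr_gt0// mulr_gt0.
have lq : l <= `|q s - q t| by rewrite ge_min lexx.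
have lL : L * l <= v t / 2.
  have : l <= v t / (2 * L) by rewrite ge_min lexx orbT.
  by rewrite ler_pdivlMr ?mulr_gt0//; lra.
have v2 : 0 <= v t / 2 by rewrite ltW// divr_gt0.
have window x : `|x - q t| <= l -> v t / 2 <= u x t.
  move=> xl; have := density_lipschitz x (q t) t0 t0.
  rewrite subrr normr0 sqrtr0 mulr0 addr0.
  move=> /le_trans /(_ (ler_wpM2l (ltW L_gt0) xl)); rewrite ler_norml; lra.
have p_mono x y : x <= y -> p t x <= p t y.
  move=> xy; rewrite -lee_fin -!pE le_measure ?inE// => w /= Bx.
  exact: le_trans xy.
have [ts|st] := leP (q t) (q s).
  rewrite ger0_norm ?subr_ge0// in lq.
  have slope := @p_slope t (q t) (q t + l) (v t / 2) t0.
  have := slope _ v2 _; rewrite lerDl => /(_ l0).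
  have win x : q t < x <= q t + l -> v t / 2 <= u x t.
    by move=> /andP[h1 h2]; apply: window; rewrite ger0_norm; lra.
  move=> /(_ win) mass.
  have := p_mono (q t + l) (q s); rewrite -lerBrDl => /(_ lq).
  have := p_time (q s) s0 t0; rewrite !p_quantile// in mass *; lra.
rewrite ltr0_norm ?subr_lt0// in lq.
have := @p_slope t (q t - l) (q t) (v t / 2) t0 _ v2; rewrite gerBl => /(_ l0).
have win x : q t - l < x <= q t -> v t / 2 <= u x t.
  by move=> /andP[h1 h2]; apply: window; rewrite ler0_norm; lra.
move=> /(_ win) mass.
have qst : q s <= q t - l by lra.
have := p_mono (q s) (q t - l) qst.
have := p_time (q s) t0 s0; rewrite distrC !p_quantile// in mass *; lra.
Qed.

(** The displacement bound at a fixed t controls q s for all s near t. The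
    absolute value extends v to the whole line. *)
Lemma quantile_density_continuous : continuous (fun t : R => v `|t|).
Proof.
move=> t; apply/cvgrPdist_lt => e e0.
have t0 : 0 <= `|t| by [].
have v0 := quantile_density_gt0 t0.
have K0 := density_K_ge0.
pose r := Num.min (v `|t| / (2 * L)) (e / (4 * L)).
have r0 : 0 < r by rewrite lt_min !divr_gt0// mulr_gt0.
pose eta := Num.min (r * v `|t| / (8 * (K + 1))) (e / (8 * L)).
have K1 : 0 < K + 1 by lra.
have eta0 : 0 < eta by rewrite lt_min !divr_gt0// mulr_gt0.
have eta2 : 0 < eta ^+ 2 by rewrite exprn_gt0.
near=> s.
have st : `|t - s| < eta ^+ 2.
  by near: s; apply: (@cvgr_dist_lt _ _ _ _ _ id).
have sig : Num.sqrt `| `|t| - `|s| | < eta.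
  have -> : eta = Num.sqrt (eta ^+ 2) by rewrite sqrtr_sqr gtr0_norm.
  rewrite ltr_sqrt//.
  by rewrite (le_lt_trans (ler_dist_dist _ _)).
set sigma := Num.sqrt _ in sig *.
have s0 : 0 <= `|s| by [].
have := quantile_displacement s0 t0; rewrite -/sigma => disp.
have sig1 : sigma * (8 * (K + 1)) < r * v `|t|.
  by rewrite -ltr_pdivlMr ?mulr_gt0// (lt_le_trans sig)// ge_min lexx.
have sig2 : sigma * (8 * L) < e.
  by rewrite -ltr_pdivlMr ?mulr_gt0// (lt_le_trans sig)// ge_min lexx orbT.
have sigma0 : 0 <= sigma by exact: sqrtr_ge0.
have qr : `|q `|s| - q `|t| | < r.
  rewrite ltNge; apply/negP => rq.
  have : r <= Num.min `|q `|s| - q `|t| | (v `|t| / (2 * L)).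
    by rewrite le_min rq ge_min lexx.
  have v2 : 0 <= v `|t| / 2 by rewrite ltW// divr_gt0.
  by move=> /(ler_wpM2r v2); nra.
have rL : L * r <= e / 4.
  have : r <= e / (4 * L) by rewrite ge_min lexx orbT.
  by rewrite ler_pdivlMr ?mulr_gt0//; lra.
have := density_lipschitz (q `|t|) (q `|s|) s0 t0; rewrite -/sigma distrC.
move=> /le_lt_trans; apply; rewrite [`|q _ - _|]distrC.
have := ler_wpM2l (ltW L_gt0) (ltW qr); lra.
Unshelve. all: end_near. Qed.

Lemma quantile_density_lower N : 0 <= N ->
  exists2 m : R, 0 < m & forall t, 0 <= t <= N -> m <= v t.
Proof.
move=> N0.
have [c cN cmin] := EVT_min N0
  (continuous_subspaceT quantile_density_continuous (A := `[0, N]%classic)).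
exists (v `|c|); first exact: quantile_density_gt0.
move=> t tN; have /andP[t0 _] := tN.
by have := cmin t; rewrite in_itv/= (ger0_norm t0); apply.
Qed.

Let joint_deficit s t :=
  alpha - fine (P [set w | B s w <= q s /\ B t w <= q t]).

Let joint_deficitE s t : 0 <= s -> 0 <= t ->
  P [set w | (q t < B t w)%R /\ (B s w <= q s)%R] = (joint_deficit s t)%:E.
Proof.
move=> s0 t0; rewrite /joint_deficit EFinB.
have mJ : measurable [set w | B s w <= q s /\ B t w <= q t].
  by apply: measurableI; exact: measurable_B_le.
rewrite fineK ?fin_num_measure// -(q_quantile s0).
have Ps_lty : (P [set w | (B s w <= q s)%R] < +oo)%E by rewrite pE ltry.
transitivity (P ([set w | B s w <= q s] `\` [set w | B t w <= q t])).
  congr (P _); apply/seteqP; split=> w /=.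
    by move=> [h ->]; split=> //; rewrite leNgt h.
  by move=> [-> /negP]; rewrite -ltNge.
by rewrite measureD.
Qed.

Let joint_deficit_itv s t : 0 <= s -> 0 <= t ->
  0 <= joint_deficit s t <= 1 /\
  joint_deficit s t <= K * (`|q s - q t| + 2 * Num.sqrt `|t - s|).
Proof.
move=> s0 t0; split; last first.
  rewrite -lee_fin -joint_deficitE//.
  by rewrite [`|q s - _|]distrC; exact: crossing_bound.
rewrite -!lee_fin -joint_deficitE// measure_ge0/=.
exact: probability_le1.
Qed.

Let rhoE s t : 0 <= s -> 0 <= t ->
  rho s t = (alpha - joint_deficit s t - alpha ^+ 2) / (v s * v t).
Proof. by move=> s0 t0; rewrite /quantile_covariance /joint_deficit subKr. Qed.

Let rho_diag t : 0 <= t -> rho t t = (alpha - alpha ^+ 2) / (v t * v t).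
Proof.
move=> t0; rewrite /quantile_covariance.
rewrite (_ : [set w | B t w <= q t /\ B t w <= q t] = [set w | B t w <= q t]).
  by rewrite q_quantile.
by apply/seteqP; split=> w /= => [[]|].
Qed.

(** Let m be a lower bound for v on [0, N]. Either |q s - q t| is within the
    window of [quantile_displacement], and then q, v and the deficit D all vary
    by O(sigma), sigma = sqrt |t - s|; or the displacement bound forces
    m^2 <= 8 K L sigma, and the trivial bound 3 / m^2 on the left-hand side is
    itself O(sigma). The constants A and A' serve these two cases. *)
Lemma covariance_increment (N : R) : 0 <= N -> exists2 c : R, 0 < c &
  forall s t, 0 <= s <= N -> 0 <= t <= N ->
  rho t t + rho s s - 2 * rho s t <= c ^+ 2 * Num.sqrt `|t - s|.
Proof.
move=> N0; have [m m0 mv] := quantile_density_lower N0.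
have K0 := density_K_ge0.
have [C1 C10 C1E] : exists2 C1 : R, 0 <= C1 & C1 * m = 4 * K.
  exists (4 * K / m); last by rewrite divfK ?gt_eqF.
  by rewrite divr_ge0 ?mulr_ge0 ?(ltW m0).
have [C2 C20 C2E] : exists2 C2 : R, 0 <= C2 & C2 = L * (C1 + 2).
  by exists (L * (C1 + 2)) => //; rewrite mulr_ge0 ?addr_ge0 ?(ltW L_gt0).
have [C3 C30 C3E] : exists2 C3 : R, 0 <= C3 & C3 = K * (C1 + 2).
  by exists (K * (C1 + 2)) => //; rewrite mulr_ge0 ?addr_ge0.
have m40 : 0 < m ^+ 4 by rewrite exprn_gt0.
have [A A0 AE] : exists2 A : R, 0 <= A &
    A * m ^+ 4 = C2 ^+ 2 * Num.sqrt N + 2 * C3 * m ^+ 2.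
  exists ((C2 ^+ 2 * Num.sqrt N + 2 * C3 * m ^+ 2) / m ^+ 4).
    apply: divr_ge0; last exact: ltW.
    by rewrite addr_ge0// mulr_ge0 ?sqr_ge0 ?sqrtr_ge0// mulr_ge0.
  by rewrite divfK ?gt_eqF.
have [A' A'0 A'E] : exists2 A' : R, 0 <= A' & A' * m ^+ 4 = 24 * K * L.
  exists (24 * K * L / m ^+ 4); last by rewrite divfK ?gt_eqF.
  apply: divr_ge0; last exact: ltW.
  by rewrite !mulr_ge0 ?(ltW L_gt0).
exists (1 + A + A'); first by lra.
move=> s t sN tN; set sigma := Num.sqrt _.
have sigma0 : 0 <= sigma by exact: sqrtr_ge0.
suff : rho t t + rho s s - 2 * rho s t <= (A + A') * sigma.
  move=> /le_trans; apply; rewrite ler_wpM2r//; nra.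
have /andP[s0 sN'] := sN; have /andP[t0 tN'] := tN.
have vs := mv _ sN; have vt := mv _ tN.
have vs0 := quantile_density_gt0 s0; have vt0 := quantile_density_gt0 t0.
rewrite !rho_diag// rhoE//.
have [/andP[d0 d1] dK] := joint_deficit_itv s0 t0.
set D := joint_deficit s t in d0 d1 dK *; rewrite -/sigma in dK.
set x := (v s)^-1; set y := (v t)^-1.
have -> : (alpha - alpha ^+ 2) / (v t * v t) +
    (alpha - alpha ^+ 2) / (v s * v s)
    - 2 * ((alpha - D - alpha ^+ 2) / (v s * v t)) =
    (alpha - alpha ^+ 2) * (x - y) ^+ 2 + 2 * D * (x * y).
  by rewrite /x /y; field; rewrite !gt_eqF.
have sigmaN : sigma <= Num.sqrt N.
  by rewrite ler_sqrt// ler_norml; lra.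
set a := alpha - alpha ^+ 2.
have /andP[a0 a1] : 0 <= a <= 1 by rewrite /a; have /andP[? ?] := alpha01; nra.
have [X0 X1] : 0 < x * m /\ x * m <= 1.
  by rewrite mulr_gt0 ?invr_gt0// mulrC ler_pdivrMr ?mul1r.
have [Y0 Y1] : 0 < y * m /\ y * m <= 1.
  by rewrite mulr_gt0 ?invr_gt0// mulrC ler_pdivrMr ?mul1r.
have xyE : x - y = (v t - v s) * (x * y).
  by rewrite /x /y; field; rewrite !gt_eqF.
rewrite -(ler_pM2r m40) [(A + A') * sigma * _]mulrAC [(A + A') * _]mulrDl.
rewrite AE A'E.
have := quantile_displacement s0 t0; rewrite -/sigma.
have [near_q|far_q] := leP `|q s - q t| (v t / (2 * L)).
  move=> disp; have dq : `|q s - q t| <= C1 * sigma.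
    rewrite -(ler_pM2r m0) mulrAC C1E.
    have := ler_wpM2l (normr_ge0 (q s - q t)) vt; nra.
  have dv : `|v t - v s| <= C2 * sigma.
    have := density_lipschitz (q t) (q s) s0 t0; rewrite -/sigma.
    move=> /le_trans; apply; rewrite C2E -mulrA ler_wpM2l ?(ltW L_gt0)//.
    by rewrite distrC; lra.
  have dD : D <= C3 * sigma.
    apply: (le_trans dK); rewrite C3E -mulrA ler_wpM2l//; lra.
  have -> : (a * (x - y) ^+ 2 + 2 * D * (x * y)) * m ^+ 4 =
      a * ((v t - v s) ^+ 2 * ((x * m) * (y * m)) ^+ 2) +
      2 * D * ((x * m) * (y * m)) * m ^+ 2.
    by rewrite xyE; ring.
  set X := x * m in X0 X1 *; set Y := y * m in Y0 Y1 *.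
  have XY0 : 0 <= X * Y by rewrite mulr_ge0 ?ltW.
  have XY1 : X * Y <= 1 by nra.
  have dv2 : (v t - v s) ^+ 2 <= C2 ^+ 2 * Num.sqrt N * sigma.
    rewrite -real_normK ?num_real//.
    apply: (@le_trans _ _ ((C2 * sigma) ^+ 2)).
      by rewrite ler_sqr ?nnegrE ?mulr_ge0.
    rewrite exprMn -mulrA ler_wpM2l ?sqr_ge0// expr2 ler_wpM2r//.
  have m20 : 0 <= m ^+ 2 by exact: sqr_ge0.
  have term1 : a * ((v t - v s) ^+ 2 * (X * Y) ^+ 2) <=
      C2 ^+ 2 * Num.sqrt N * sigma.
    apply: le_trans dv2; rewrite mulrCA -[leRHS]mulr1 ler_wpM2l ?sqr_ge0//.
    by have := sqr_ge0 (X * Y); nra.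
  have term2 : 2 * D * (X * Y) * m ^+ 2 <= 2 * C3 * m ^+ 2 * sigma.
    rewrite [leRHS]mulrAC ler_wpM2r//; nra.
  have : 0 <= 24 * K * L * sigma by rewrite !mulr_ge0 ?(ltW L_gt0).
  by move: term1 term2; rewrite !mulrDl; lra.
move=> disp; have m2 : m ^+ 2 <= 8 * K * L * sigma.
  have v2 : v t ^+ 2 = v t / (2 * L) * (v t / 2) * (4 * L).
    by field; rewrite gt_eqF.
  have m2v : m ^+ 2 <= v t ^+ 2 by rewrite ler_sqr ?nnegrE ?(ltW m0) ?(ltW vt0).
  apply: (le_trans m2v); rewrite v2.
  have L4 : 0 <= 4 * L by rewrite mulr_ge0 ?(ltW L_gt0).
  by have := ler_wpM2r L4 disp; lra.
have -> : (a * (x - y) ^+ 2 + 2 * D * (x * y)) * m ^+ 4 =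
    (a * (x * m - y * m) ^+ 2 + 2 * D * ((x * m) * (y * m))) * m ^+ 2 by ring.
set X := x * m in X0 X1 *; set Y := y * m in Y0 Y1 *.
have XY0 : 0 <= X * Y by rewrite mulr_ge0 ?ltW.
have XY1 : X * Y <= 1 by nra.
have XmY : (X - Y) ^+ 2 <= 1 by nra.
have bound : a * (X - Y) ^+ 2 + 2 * D * (X * Y) <= 3.
  have : a * (X - Y) ^+ 2 <= 1 by have := sqr_ge0 (X - Y); nra.
  have : D * (X * Y) <= 1 by nra.
  lra.
apply: (le_trans (ler_wpM2r (sqr_ge0 m) bound)).
have : 0 <= C2 ^+ 2 * Num.sqrt N * sigma.
  by rewrite !mulr_ge0 ?sqr_ge0 ?sqrtr_ge0.
have : 0 <= 2 * C3 * m ^+ 2 * sigma by rewrite !mulr_ge0// ltW.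
by rewrite !mulrDl; lra.
Qed.

End brownian_quantiles.

(** * Increments of a Gaussian process *)

Section second_moments.
Context d (T : measurableType d) (R : realType) (Q : probability T R).
Implicit Types X Y : {RV Q >-> R}.

Let integrable_square X (a : R) :
  ('E_Q[(fun w => (X w * X w)%R)] = a%:E)%E ->
  Q.-integrable setT (fun w => (X w * X w)%:E).
Proof.
rewrite unlock => Xa; apply/integrableP; split.
  by apply/measurable_EFinP; exact: measurable_funM.
under eq_integral do rewrite /= ger0_norm -?expr2 ?sqr_ge0// expr2.
by rewrite Xa ltry.
Qed.

Lemma expectation_square_increment X Y (a b c : R) :
  ('E_Q[(fun w => (X w * X w)%R)] = a%:E)%E ->
  ('E_Q[(fun w => (Y w * Y w)%R)] = b%:E)%E ->
  ('E_Q[(fun w => (X w * Y w)%R)] = c%:E)%E ->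
  (\int[Q]_w ((Y w - X w) ^+ 2)%:E = (b + a - 2 * c)%:E)%E.
Proof.
move=> Xa Yb XYc.
have iX := integrable_square Xa; have iY := integrable_square Yb.
have iXY : Q.-integrable setT (fun w => (X w * Y w)%:E).
  apply: (le_integrable measurableT _ _ (integrableD measurableT iX iY)).
    by apply/measurable_EFinP; exact: measurable_funM.
  move=> w _ /=; rewrite lee_fin [leRHS]ger0_norm; last first.
    by rewrite addr_ge0// -expr2 sqr_ge0.
  rewrite ler_norml.
  have := sqr_ge0 (X w + Y w); have := sqr_ge0 (X w - Y w).
  by have := sqr_ge0 (X w); have := sqr_ge0 (Y w); nra.
have iXY2 : Q.-integrable setT (fun w => (- 2)%:E * (X w * Y w)%:E)%E.
  exact: integrableZl.
rewrite (_ : (\int[Q]_w _)%E = (\int[Q]_w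
    (((Y w * Y w)%:E + (X w * X w)%:E) + (- 2)%:E * (X w * Y w)%:E))%E);
  last first.
  apply: eq_integral => w _; rewrite -EFinM -!EFinD; congr (_%:E); ring.
rewrite integralD//=; last exact: integrableD.
rewrite integralD//= integralZl//=.
rewrite unlock in Xa Yb XYc; rewrite Xa Yb XYc -EFinM -!EFinD mulNr.
by [].
Qed.

Lemma gaussian_process_increment (F : R -> {RV Q >-> R}) : gaussian_process F ->
  forall s t, 0 <= s -> 0 <= t -> exists m sigma : R, forall A : set R,
  measurable A -> Q [set w | A (F t w - F s w)] = gauss_law m sigma A.
Proof.
move=> FG s t s0 t0.
pose times (i : 'I_2) : R := if i == ord0 then t else s.
pose signs (i : 'I_2) : R := if i == ord0 then 1 else -1.
have [|m [sigma FE]] := FG 2%N times signs.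
  by move=> i; rewrite /times; case: ifP.
exists m, sigma => A mA; rewrite -(FE A mA); congr (Q _); apply/funext => w /=.
by rewrite !big_ord_recl big_ord0 /signs /times/= mul1r mulN1r addr0.
Qed.

End second_moments.

(** * Bounds for Schwartz functions *)

Section schwartz_bounds.
Variables (R : realType) (f : R -> R).
Hypothesis f_schwartz : schwartz f.

Let f_derivable x : derivable f x 1.
Proof. by case: f_schwartz => /(_ 0%N x). Qed.

Lemma schwartz_continuous : continuous f.
Proof.
move=> x; apply/differentiable_continuous/derivable1_diffP.
exact: f_derivable.
Qed.

Let derive1n_bounded m :
  exists2 C : R, 0 < C & forall x, `|derive1n m f x| <= C.
Proof.
have [_ /(_ 0%N m)[C fC]] := f_schwartz.
exists (`|C| + 1); first by rewrite ltr_wpDl.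
move=> x; have := fC x; rewrite expr0.
by have := ler_norm C; have := normr_ge0 (derive1n m f x); lra.
Qed.

Lemma schwartz_bounded : exists K : R, forall x, f x <= K.
Proof.
have [K _ fK] := derive1n_bounded 0; exists K => x.
exact: le_trans (ler_norm _) (fK x).
Qed.

Lemma schwartz_lipschitz :
  exists2 L : R, 0 < L & forall x y, `|f x - f y| <= L * `|x - y|.
Proof.
have [L L0 fL] := derive1n_bounded 1; exists L => // x y.
wlog xy : x y / x < y.
  move=> th; have [/th//|yx|->] := ltgtP x y; last first.
    by rewrite !subrr normr0 mulr0.
  by rewrite distrC [`|x - y|]distrC th.
have f_derive z : z \in `]x, y[ -> is_derive z 1 f (derive1 f z).
  by move=> _; rewrite derive1E; exact/derivableP.
have [c _ fc] := MVT xy f_derive (continuous_subspaceT schwartz_continuous).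
by rewrite distrC [`|x - y|]distrC fc normrM ler_wpM2r//; exact: fL.
Qed.

End schwartz_bounds.

(** * Hoelder modification of the quantile fluctuation process *)

Theorem corollary3p3 (R : realType) (alpha : R) (halpha : 0 < alpha < 1)
  (f : R -> R) (hf : schwartz f)
  (* the Brownian motion B *)
  (d : measure_display) (Omega : measurableType d) (P : probability Omega R)
  (B W : R -> {RV P >-> R})
  (hW : standard_brownian_motion W)
  (hBW : forall t w, 0 <= t -> B t w = B 0 w + W t w)
  (hindep : independent_sigma P
              (preimage_set_system setT (B 0) measurable) (process_sigma W))
  (hB0 : is_density (distribution P (B 0)) f)
  (* u(., t) is the continuous version of the density of B(t); since f is
     continuous, this forces u(., 0) = f *)
  (u : R -> R -> R)
  (hu : forall t, 0 <= t ->
     is_density (distribution P (B t)) (fun x => u x t) /\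
     continuous (fun x => u x t))
  (q : R -> R)
  (hq0 : is_unique_quantile alpha (law_of_density f) (q 0))
  (hfq0 : 0 < f (q 0))
  (hq : forall t, 0 < t -> is_quantile alpha (distribution P (B t)) (q t))
  (* the Gaussian process F, possibly on another probability space *)
  (d' : measure_display) (Omega' : measurableType d') (Q : probability Omega' R)
  (F : R -> {RV Q >-> R})
  (hFgauss : gaussian_process F)
  (hFcentered : centered F)
  (hFcov : has_covariance F (quantile_covariance alpha B q u)) :
  exists G : R -> {RV Q >-> R},
    modification F G /\
    forall gamma : R, 0 < gamma < 4^-1 ->
      forall w : Omega', locally_holder gamma (fun t => G t w).
Proof.
have fq0_density : P [set w | (B 0 w <= q 0)%R] = alpha%:E.
  case: hB0 => _ _ B0E; case: hq0 => <- _.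
  by rewrite -B0E//; exact: measurable_itv.
have q_quantile t : 0 <= t -> P [set w | (B t w <= q t)%R] = alpha%:E.
  by rewrite le_eqVlt => /predU1P[<-//|t0]; exact: hq.
have [K f_le] := schwartz_bounded hf.
have [L L0 f_lip] := schwartz_lipschitz hf.
have BE w t : 0 <= t -> B t w = B 0 w + W t w by exact: hBW.
apply: gaussian_holder_modification; first exact: gaussian_process_increment.
move=> N.
have N0 : 0 <= N%:R :> R by [].
have [c c0 cov] := covariance_increment hW BE hindep hB0 f_le L0 f_lip hu
  halpha q_quantile (schwartz_continuous hf) hfq0 N0.
exists c => // s t sN tN; have /andP[s0 _] := sN; have /andP[t0 _] := tN.
rewrite (expectation_square_increment (hFcov s s s0 s0) (hFcov t t t0 t0)
  (hFcov s t s0 t0)).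
by rewrite lee_fin; exact: cov.
Qed.
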